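(* Let $\mathcal{C}$ be a $\bar G$-graded $\bar G$-acted $\mathcal{O}$-algebra and let $A$, $A'$, $A''$ be three $\bar G$-graded crossed products over $\mathcal{C}$, with identity components $B,B',B''$, and let $u'_{\bar g}\in A'_{\bar g}$ be invertible homogeneous elements. For two such crossed products $X,Y$ over $\mathcal C$ and a $\Delta(X\otimes_{\mathcal{C}}Y^{\mathrm{op}})$-module $M$ write $\widetilde M=(X\otimes_{\mathcal{C}}Y^{\mathrm{op}})\otimes_{\Delta(X\otimes_{\mathcal{C}}Y^{\mathrm{op}})}M\ (\simeq X\otimes_{X_1}M\simeq M\otimes_{Y_1}Y)$. (1) Let $M$ be a $\Delta(A\otimes_{\mathcal{C}}A'^{\mathrm{op}})$-module and $M'$ a $\Delta(A'\otimes_{\mathcal{C}}A''^{\mathrm{op}})$-module. Then $M\otimes_{B'}M'$ is a $\Delta(A\otimes_{\mathcal{C}}A''^{\mathrm{op}})$-module with $$(a\otimes a'')(m\otimes m')=(a\otimes u'^{-1}_{\bar g})m\otimes(u'_{\bar g}\otimes a'')m'$$ for all $\bar g\in\bar G$, $a\in A_{\bar g}$, $a''\in A''_{\bar g^{-1}}$, $m\in M$, $m'\in M'$. Moreover, there is an isomorphism $\widetilde{M\otimes_{B'}M'}\simeq\widetilde M\otimes_{A'}\widetilde{M'}$ of $\bar G$-graded $(A,A'')$-bimodules over $\mathcal{C}$. (2) Let $M$ be a $\Delta(A'\otimes_{\mathcal{C}}A^{\mathrm{op}})$-module and $M'$ a $\Delta(A'\otimes_{\mathcal{C}}A''^{\mathrm{op}})$-module.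 Then $\mathrm{Hom}_{B'}(M,M')$ is a $\Delta(A\otimes_{\mathcal{C}}A''^{\mathrm{op}})$-module with $$((a\otimes a'')f)(m)=(u'_{\bar g}\otimes a'')f\big((u'^{-1}_{\bar g}\otimes a)m\big)$$ for all $\bar g\in\bar G$, $a\in A_{\bar g}$, $a''\in A''_{\bar g^{-1}}$, $m\in M$, $f\in\mathrm{Hom}_{B'}(M,M')$. Moreover, there is an isomorphism $\widetilde{\mathrm{Hom}_{B'}(M,M')}\simeq\mathrm{Hom}_{A'}(\widetilde M,\widetilde{M'})$ of $\bar G$-graded $(A,A'')$-bimodules over $\mathcal{C}$.
   Context: $\mathcal{O}$ is a complete discrete valuation ring and $\bar G=G/N$, where $G$ is a finite group and $N$ a normal subgroup. A $\bar G$-graded $\mathcal{O}$-algebra $A=\bigoplus_{\bar g\in\bar G}A_{\bar g}$ is a crossed product if each $A_{\bar g}$ contains an invertible element $u_{\bar g}$ of $A$; its identity component is $B=A_1$. A $\bar G$-graded $\bar G$-acted $\mathcal{O}$-algebra is a $\bar G$-graded $\mathcal{O}$-algebra $\mathcal{C}=\bigoplus_{\bar g}\mathcal{C}_{\bar g}$ with a left action of $\bar G$ (by $\mathcal{O}$-algebra automorphisms), $c\mapsto{}^{\bar g}c$, such that ${}^{\bar g}\mathcal{C}_{\bar h}\subseteq\mathcal{C}_{\bar g\bar h\bar g^{-1}}$. Example: the centralizer $C_A(B)$ with components $C_A(B)_{\bar h}=C_A(B)\cap A_{\bar h}$ and action ${}^{\bar g}c=u_{\bar g}cu_{\bar g}^{-1}$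 (independent of the choice of $u_{\bar g}$). $A$ is over $\mathcal{C}$ if it is equipped with a grade-preserving, $\bar G$-equivariant algebra homomorphism $\zeta:\mathcal{C}\to C_A(B)$. $\mathcal{C}$ acts on $A$-modules through $\zeta$; similarly for the other algebras over $\mathcal{C}$. For crossed products $X,Y$ over $\mathcal{C}$, a $\bar G$-graded $(X,Y)$-bimodule over $\mathcal{C}$ is an $(X,Y)$-bimodule $\tilde M=\bigoplus_{\bar g}\tilde M_{\bar g}$ with $X_{\bar g}\tilde M_{\bar x}Y_{\bar h}\subseteq\tilde M_{\bar g\bar x\bar h}$ and $\tilde m_{\bar g}\cdot c={}^{\bar g}c\cdot\tilde m_{\bar g}$ for all $c\in\mathcal{C}$, $\tilde m_{\bar g}\in\tilde M_{\bar g}$; isomorphisms of such are grade-preserving bimodule isomorphisms. The tensor product $X\otimes_{\mathcal{C}}Y^{\mathrm{op}}$ is formed with $xc\otimes y=x\otimes cy$ (product $cy$ taken in $Y$). $\Delta(X\otimes_{\mathcal{C}}Y^{\mathrm{op}})$ is the $\mathcal{O}$-submodule $\sum_{\bar g}X_{\bar g}\otimes_{\mathcal{C}}Y_{\bar g^{-1}}$ spanned by the $x\otimes y$ with $x\in X_{\bar g}$, $y\in Y_{\bar g^{-1}}$; it is an $\mathcal{O}$-algebra with $(x\otimes y)(x_1\otimes y_1)=xx_1\otimes y_1y$ (products on the right in $X$ and $Y$). $X\otimes_{\mathcal{C}}Y^{\mathrm{op}}$ is a right module over it by the same formula and a $\bar G$-graded $(X,Y)$-bimodule over $\mathcal{C}$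 via $s(x\otimes y)t=sx\otimes yt$, with $\bar z$-component spanned by $x\otimes y$, $x\in X_{\bar g},y\in Y_{\bar h}$, $\bar g\bar h=\bar z$; $\widetilde M$ inherits its structure and grading from this factor. A $\Delta(X\otimes_{\mathcal{C}}Y^{\mathrm{op}})$-module $M$ is an $(X_1,Y_1)$-bimodule via $xmy=(x\otimes y)m$. $\widetilde M\otimes_{A'}\widetilde{M'}$ is graded by giving $\widetilde M_{\bar t}\otimes\widetilde{M'}_{\bar t'}$ degree $\bar t\bar t'$. $\mathrm{Hom}_{A'}(\widetilde M,\widetilde{M'})$ is the set of left $A'$-linear maps with $(afa'')(m)=f(ma)a''$ and $\bar x$-component $\{f\mid f(\widetilde M_{\bar g})\subseteq\widetilde{M'}_{\bar g\bar x}\ \forall\bar g\in\bar G\}$. *)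

(* Defs.v *)
From HB Require Import structures.
From mathcomp Require Import all_boot all_order all_fingroup all_algebra.
From mathcomp Require Import generic_quotient ring_quotient.
From mathcomp Require Import boolp functions.
From mathcomp.multinomials Require Import freeg.

Set Implicit Arguments.
Unset Strict Implicit.
Unset Printing Implicit Defensive.

Import GRing.Theory.
Local Open Scope ring_scope.

Section CompleteDVR.
Variable O : idomainType.

Definition is_ideal (I : O -> Prop) : Prop :=
  [/\ I 0, forall x y, I x -> I y -> I (x + y) & forall a x, I x -> I (a * x)].

Definition principal_ideal (p x : O) : Prop := exists a, x = a * p.

Definition is_maximal_ideal (m : O -> Prop) : Prop :=
  [/\ is_ideal m, ~ m 1 &
      forall I, is_ideal I -> ~ I 1 ->
        (forall x, m x -> I x) -> forall x, I x -> m x].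

Definition is_dvr : Prop :=
  (forall I, is_ideal I -> exists p, forall x, I x <-> principal_ideal p x) /\
  (exists m, [/\ is_maximal_ideal m, exists2 x, m x & x != 0 &
     forall m', is_maximal_ideal m' -> (exists2 x, m' x & x != 0) ->
       forall x, m' x <-> m x]).

(* If the maximal ideal is generated by p, its n-th power is generated by
   p ^+ n; completeness says that O -> lim_n O / (p ^+ n) is bijective. *)
Definition is_complete : Prop :=
  forall p, is_maximal_ideal (principal_ideal p) ->
  forall u : nat -> O,
    (forall n, principal_ideal (p ^+ n) (u n.+1 - u n)) ->
    exists! l, forall n, principal_ideal (p ^+ n) (l - u n).

Definition is_complete_dvr : Prop := is_dvr /\ is_complete.

End CompleteDVR.

Section Span.
Variable V : zmodType.

Inductive zspan (S : V -> Prop) : V -> Prop :=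
| zspan0 : zspan S 0
| zspanB x y : zspan S x -> zspan S y -> zspan S (x - y)
| zspan_gen x : S x -> zspan S x.

Lemma zspanN S x : zspan S x -> zspan S (- x).
Proof. by move=> Sx; rewrite -sub0r; apply: zspanB => //; apply: zspan0. Qed.

Lemma zspanD S x y : zspan S x -> zspan S y -> zspan S (x + y).
Proof. by move=> Sx Sy; rewrite -[y]opprK; apply/zspanB/zspanN. Qed.

Lemma zspan_sum S (I : finType) (F : I -> V) :
  (forall i, zspan S (F i)) -> zspan S (\sum_i F i).
Proof. by move=> SF; elim/big_ind: _ => // [|x y]; [exact: zspan0|exact: zspanD]. Qed.

End Span.

Section Grading.
Variables (gbar : finGroupType) (V : zmodType).

Record is_grading (comp : gbar -> V -> Prop) : Prop := IsGrading {
  grading0 : forall g, comp g 0;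
  gradingB : forall g x y, comp g x -> comp g y -> comp g (x - y);
  grading_exists : forall x, exists f : gbar -> V,
    (forall g, comp g (f g)) /\ x = \sum_g f g;
  grading_unique : forall f : gbar -> V, (forall g, comp g (f g)) ->
    \sum_g f g = 0 -> forall g, f g = 0 }.

Section Proj.
Variables (comp : gbar -> V -> Prop) (gr : is_grading comp).

Definition hproj (g : gbar) (x : V) : V := projT1 (cid (grading_exists gr x)) g.

Lemma hproj_comp g x : comp g (hproj g x).
Proof. by rewrite /hproj; case: cid => f []. Qed.

Lemma hproj_sum x : x = \sum_g hproj g x.
Proof. by rewrite /hproj; case: cid => f []. Qed.

Lemma gradingN g x : comp g x -> comp g (- x).
Proof. by move=> cx; rewrite -sub0r; apply: (gradingB gr) => //; apply: (grading0 gr). Qed.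

Lemma gradingD g x y : comp g x -> comp g y -> comp g (x + y).
Proof. by move=> cx cy; rewrite -[y]opprK; apply/(gradingB gr)/gradingN. Qed.

Lemma hproj_eq (f : gbar -> V) x : (forall g, comp g (f g)) ->
  x = \sum_g f g -> forall g, hproj g x = f g.
Proof.
move=> cf xE g; apply/eqP; rewrite -subr_eq0; apply/eqP.
apply: (grading_unique gr (f := fun g => hproj g x - f g)).
  by move=> h; apply: (gradingB gr) => //; apply: hproj_comp.
by rewrite sumrB -hproj_sum -xE subrr.
Qed.

Lemma hproj0 g : hproj g 0 = 0.
Proof.
by apply: (hproj_eq (f := fun=> 0)) => [h|]; [exact: (grading0 gr)|rewrite big1].
Qed.

Lemma hprojB g x y : hproj g (x - y) = hproj g x - hproj g y.
Proof.
apply: (hproj_eq (f := fun g => hproj g x - hproj g y)) => [h|].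
  by apply: (gradingB gr) => //; apply: hproj_comp.
by rewrite sumrB -!hproj_sum.
Qed.

Lemma hprojN g x : hproj g (- x) = - hproj g x.
Proof. by rewrite -sub0r hprojB hproj0 sub0r. Qed.

Lemma hprojD g x y : hproj g (x + y) = hproj g x + hproj g y.
Proof. by rewrite -[y]opprK hprojB hprojN !opprK. Qed.

Lemma hproj_hom g h x : comp h x -> hproj g x = if g == h then x else 0.
Proof.
move=> cx; apply: (hproj_eq (f := fun g => if g == h then x else 0)).
  by move=> k; case: eqP => [->|_] //; apply: (grading0 gr).
by rewrite -big_mkcond big_pred1_eq.
Qed.

Lemma hproj_id g x : comp g x -> hproj g x = x.
Proof. by move=> /hproj_hom->; rewrite eqxx. Qed.

End Proj.

Lemma grading_of_proj (comp : gbar -> V -> Prop) (p : gbar -> V -> V) :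
    (forall g, comp g 0) ->
    (forall g x y, comp g x -> comp g y -> comp g (x - y)) ->
    (forall g x y, p g (x + y) = p g x + p g y) ->
    (forall g x, comp g (p g x)) -> (forall x, x = \sum_g p g x) ->
    (forall g h x, comp h x -> p g x = if g == h then x else 0) ->
  is_grading comp.
Proof.
move=> c0 cB pD pc ps ph; split=> // [x|f cf f0 g].
  by exists (p^~ x).
have p0 : p g 0 = 0 by apply/(addrI (p g 0)); rewrite -pD !addr0.
have := congr1 (p g) f0; rewrite p0 (big_morph (p g) (pD g) p0).
under eq_bigr => h _ do rewrite (ph _ _ _ (cf h)).
by rewrite -big_mkcond (big_pred1 g) // => h /=; rewrite eq_sym.
Qed.

End Grading.

(* [tensor ra la] is the abelian group M (x)_K N, where K acts on the right of M
   through [ra] and on the left of N through [la]: the free abelian group on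
   M * N modulo biadditivity and the relations (m k) (x) n = m (x) (k n). *)
Section Tensor.
Variables (K : Type) (M N : zmodType) (ra : M -> K -> M) (la : K -> N -> N).

Notation pairs := {freeg (M * N)%type / int}.
Let pair_gen (m : M) (n : N) : pairs := << (m, n) >>.

Inductive tensor_rel : pairs -> Prop :=
| tensor_relDl m1 m2 n : tensor_rel
    (pair_gen (m1 + m2) n - (pair_gen m1 n + pair_gen m2 n))
| tensor_relDr m n1 n2 : tensor_rel
    (pair_gen m (n1 + n2) - (pair_gen m n1 + pair_gen m n2))
| tensor_relA m k n : tensor_rel (pair_gen (ra m k) n - pair_gen m (la k n)).

Definition tensor_ker : {pred pairs} := fun x => `[< zspan tensor_rel x >].

Lemma tensor_ker_closed : zmod_closed tensor_ker.
Proof.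
split=> [|x y /asboolP Kx /asboolP Ky]; apply/asboolP; first exact: zspan0.
exact: zspanB.
Qed.

HB.instance Definition _ := GRing.isZmodClosed.Build pairs tensor_ker
  tensor_ker_closed.

Definition tensor : Type := Quotient.quot tensor_ker.
HB.instance Definition _ := GRing.Zmodule.on tensor.

Definition tpure (m : M) (n : N) : tensor := \pi_(Quotient.quot tensor_ker)%qT (pair_gen m n).


Lemma tpure_eq x y : zspan tensor_rel (x - y) ->
  \pi_(Quotient.quot tensor_ker)%qT x = \pi_(Quotient.quot tensor_ker)%qT y.
Proof. by move=> xy; apply/eqP; rewrite -Quotient.idealrBE; apply/asboolP. Qed.

Lemma tpureDl m1 m2 n : tpure (m1 + m2) n = tpure m1 n + tpure m2 n.
Proof.
by rewrite /tpure -[RHS]raddfD; apply/tpure_eq/zspan_gen; constructor.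
Qed.

Lemma tpureDr m n1 n2 : tpure m (n1 + n2) = tpure m n1 + tpure m n2.
Proof.
by rewrite /tpure -[RHS]raddfD; apply/tpure_eq/zspan_gen; constructor.
Qed.

Lemma tpureA m k n : tpure (ra m k) n = tpure m (la k n).
Proof. by apply/tpure_eq/zspan_gen; constructor. Qed.

Lemma tpure0l n : tpure 0 n = 0.
Proof. by apply: (addrI (tpure 0 n)); rewrite -tpureDl !addr0. Qed.

Lemma tpure0r m : tpure m 0 = 0.
Proof. by apply: (addrI (tpure m 0)); rewrite -tpureDr !addr0. Qed.

Lemma tpureNl m n : tpure (- m) n = - tpure m n.
Proof. by apply: (addrI (tpure m n)); rewrite -tpureDl !subrr tpure0l. Qed.

Lemma tpureNr m n : tpure m (- n) = - tpure m n.
Proof. by apply: (addrI (tpure m n)); rewrite -tpureDr !subrr tpure0r. Qed.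

Lemma tpure_suml (I : Type) (r : seq I) (P : pred I) (F : I -> M) n :
  tpure (\sum_(i <- r | P i) F i) n = \sum_(i <- r | P i) tpure (F i) n.
Proof.
by apply: (big_morph (tpure^~ n)) => [x y|]; rewrite (tpureDl, tpure0l).
Qed.

Lemma tpure_sumr (I : Type) (r : seq I) (P : pred I) m (F : I -> N) :
  tpure m (\sum_(i <- r | P i) F i) = \sum_(i <- r | P i) tpure m (F i).
Proof.
by apply: (big_morph (tpure m)) => [x y|]; rewrite (tpureDr, tpure0r).
Qed.

Lemma tensor_sum (t : tensor) :
  exists s : seq (M * N), t = \sum_(p <- s) tpure p.1 p.2.
Proof.
pose Q t := exists s : seq (M * N), t = \sum_(p <- s) tpure p.1 p.2.
have Q0 : Q 0 by exists [::]; rewrite big_nil.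
have QD x y : Q x -> Q y -> Q (x + y).
  by move=> [s ->] [s' ->]; exists (s ++ s'); rewrite big_cat.
have QN x : Q x -> Q (- x).
  move=> [s ->]; exists [seq (- p.1, p.2) | p <- s]; rewrite big_map -sumrN.
  by apply: eq_bigr => p _; rewrite tpureNl.
have Qmul x n : Q x -> Q (x *+ n).
  by move=> Qx; elim: n => [|n IHn]; rewrite ?mulr0n // mulrS; apply: QD.
suff: Q t by []; elim/quotW: t => x; rewrite -[x]freeg_sumE raddf_sum.
apply: big_ind => [//|//|[m n] _].
have Qp : Q (tpure m n) by exists [:: (m, n)]; rewrite big_seq1.
rewrite -[coeff _ _]intz -freegU_mulz raddfMz -/(tpure m n).
by case: (coeff _ _) => k; [apply: Qmul|apply/QN/Qmul].
Qed.

Lemma tensor_ind (P : tensor -> Prop) :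
    (forall m n, P (tpure m n)) -> (forall x y, P x -> P y -> P (x + y)) ->
  forall t, P t.
Proof.
move=> Pp PD t; have [s ->] := tensor_sum t.
by elim/big_ind: _ => [|//|p _]; rewrite -?(tpure0l 0); apply: Pp.
Qed.

Section Lift.
Variable V : zmodType.

Record balanced (f : M -> N -> V) : Prop := Balanced {
  balancedDl : forall m1 m2 n, f (m1 + m2) n = f m1 n + f m2 n;
  balancedDr : forall m n1 n2, f m (n1 + n2) = f m n1 + f m n2;
  balancedA : forall m k n, f (ra m k) n = f m (la k n) }.

Definition tlift (f : M -> N -> V) (t : tensor) : V :=
  fglift (fun p : M * N => f p.1 p.2 : zmodule V) (repr t).

Variables (f : M -> N -> V) (fbal : balanced f).

Let flift := fglift (fun p : M * N => f p.1 p.2 : zmodule V).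

Let fliftB x y : flift (x - y) = flift x - flift y.
Proof. exact: lift_is_additive. Qed.

Let fliftD x y : flift (x + y) = flift x + flift y.
Proof.
have flift0 : flift 0 = 0 by rewrite -(subrr 0) fliftB subrr.
have fliftN z : flift (- z) = - flift z by rewrite -sub0r fliftB flift0 sub0r.
by rewrite -[y]opprK fliftB [flift (- y)]fliftN !opprK.
Qed.

Let flift_gen m n : flift (pair_gen m n) = f m n.
Proof. by rewrite /flift liftU scalezrE mulr1z. Qed.

Let flift_ker x : zspan tensor_rel x -> flift x = 0.
Proof.
elim=> [|{}x y _ x0 _ y0|{}x]; first by rewrite -(subrr 0) fliftB subrr.
  by rewrite fliftB x0 y0 subrr.
case=> [m1 m2 n|m n1 n2|m k n]; rewrite fliftB ?fliftD !flift_gen.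
- by rewrite balancedDl // subrr.
- by rewrite balancedDr // subrr.
- by rewrite balancedA // subrr.
Qed.

Let tlift_pi x : tlift f (\pi_(Quotient.quot tensor_ker)%qT x) = flift x.
Proof.
apply/eqP; rewrite -subr_eq0 -fliftB; apply/eqP/flift_ker/asboolP.
by rewrite -/(tensor_ker _) -[_ (_ - _)]/(_ \in tensor_ker) Quotient.idealrBE reprK.
Qed.

Lemma tlift_pure m n : tlift f (tpure m n) = f m n.
Proof. by rewrite tlift_pi flift_gen. Qed.

Lemma tliftD x y : tlift f (x + y) = tlift f x + tlift f y.
Proof.
elim/quotW: x => x; elim/quotW: y => y.
by rewrite -[_ + _]raddfD !tlift_pi fliftD.
Qed.

Lemma tlift_is_zmod_morphism : zmod_morphism (tlift f).
Proof. by move=> x y; apply/eqP; rewrite eq_sym subr_eq -tliftD subrK. Qed.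

End Lift.

Lemma tensor_eq (V : zmodType) (f g : tensor -> V) :
    (forall x y, f (x + y) = f x + f y) -> (forall x y, g (x + y) = g x + g y) ->
    (forall m n, f (tpure m n) = g (tpure m n)) -> forall t, f t = g t.
Proof.
by move=> fD gD fg; elim/tensor_ind => [//|x y fx fy]; rewrite fD gD fx fy.
Qed.

End Tensor.

Notation "m ⊗ n" := (tpure _ _ m n) (at level 40, left associativity) : ring_scope.

Lemma additive_sum (U V : zmodType) (f : U -> V) :
    (forall x y, f (x + y) = f x + f y) ->
  forall (I : Type) (r : seq I) (P : pred I) (F : I -> U),
    f (\sum_(i <- r | P i) F i) = \sum_(i <- r | P i) f (F i).
Proof.
by move=> fD I r P F; apply: big_morph => //; apply: (addrI (f 0)); rewrite -fD !addr0.
Qed.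

Section GradedTensor.
Variables (gbar : finGroupType) (V K W : zmodType).
Variables (cV : gbar -> V -> Prop) (cK : gbar -> K -> Prop) (cW : gbar -> W -> Prop).
Hypotheses (grV : is_grading cV) (grK : is_grading cK) (grW : is_grading cW).
Variables (ra : V -> K -> V) (la : K -> W -> W).
Hypotheses (raDl : forall v1 v2 k, ra (v1 + v2) k = ra v1 k + ra v2 k)
           (raDr : forall v k1 k2, ra v (k1 + k2) = ra v k1 + ra v k2)
           (laDl : forall k1 k2 w, la (k1 + k2) w = la k1 w + la k2 w)
           (laDr : forall k w1 w2, la k (w1 + w2) = la k w1 + la k w2).
Hypotheses (ra_comp : forall g h v k, cV g v -> cK h k -> cV (g * h)%g (ra v k))
           (la_comp : forall g h k w, cK g k -> cW h w -> cW (g * h)%g (la k w)).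

Definition tensor_comp (z : gbar) : tensor ra la -> Prop :=
  zspan (fun t => exists g h v w, [/\ cV g v, cW h w, (g * h)%g = z & t = v ⊗ w]).

Lemma grading_sumP (U : zmodType) (c : gbar -> U -> Prop) (gr : is_grading c) g
  (I : Type) (r : seq I) (F : I -> U) :
  (forall i, c g (F i)) -> c g (\sum_(i <- r) F i).
Proof.
move=> cF; elim/big_ind: _ => // [|x y]; [exact: (grading0 gr)|exact: (gradingD gr)].
Qed.

Lemma hproj_ra g v k : hproj grV g (ra v k) =
  \sum_h ra (hproj grV (g * h^-1)%g v) (hproj grK h k).
Proof.
apply: (@hproj_eq _ _ _ grV (fun g => \sum_h ra _ _)) => [{}g|].
  apply: (grading_sumP grV) => h; rewrite -[g in cV g](mulgKV h).
  by apply: ra_comp; apply: hproj_comp.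
rewrite exchange_big /= [in LHS](hproj_sum grK k) (additive_sum (raDr v)).
apply: eq_bigr => h _; rewrite [in LHS](hproj_sum grV v).
rewrite (@additive_sum _ _ (ra^~ (hproj grK h k))) //.
by rewrite (reindex_inj (mulIg h^-1%g)).
Qed.

Lemma hproj_la g k w : hproj grW g (la k w) =
  \sum_h la (hproj grK h k) (hproj grW (h^-1 * g)%g w).
Proof.
apply: (@hproj_eq _ _ _ grW (fun g => \sum_h la _ _)) => [{}g|].
  apply: (grading_sumP grW) => h; rewrite -[g in cW g](mulKVg h).
  by apply: la_comp; apply: hproj_comp.
rewrite exchange_big /= [in LHS](hproj_sum grK k).
rewrite (@additive_sum _ _ (la^~ w)) //.
apply: eq_bigr => h _; rewrite [in LHS](hproj_sum grW w).
rewrite (additive_sum (laDr _)).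
by rewrite (reindex_inj (mulgI h^-1%g)).
Qed.

Lemma balanced_hproj (U : zmodType) (F : V -> W -> U) (z : gbar) :
    balanced ra la F ->
  balanced ra la (fun v w =>
    \sum_g F (hproj grV g v) (hproj grW (g^-1 * z)%g w)).
Proof.
move=> [FDl FDr FA]; split=> [v1 v2 w|v w1 w2|v k w].
- by rewrite -big_split; apply: eq_bigr => g _; rewrite hprojD FDl.
- by rewrite -big_split; apply: eq_bigr => g _; rewrite hprojD FDr.
under eq_bigr => g _.
  rewrite hproj_ra (@additive_sum _ _ (F^~ _)) //.
  under eq_bigr => h _ do rewrite FA.
  over.
under [RHS]eq_bigr => g _ do rewrite hproj_la (additive_sum (FDr _)).
rewrite exchange_big [RHS]exchange_big /=; apply: eq_bigr => h _.
rewrite (reindex_inj (mulIg h)); apply: eq_bigr => l _ /=.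
by rewrite mulgK invMg !mulgA.
Qed.

Lemma balanced_tpure : balanced ra la (tpure ra la).
Proof. by split=> *; rewrite (tpureDl, tpureDr, tpureA). Qed.

Definition tproj (z : gbar) : tensor ra la -> tensor ra la :=
  tlift (fun v w => \sum_g hproj grV g v ⊗ hproj grW (g^-1 * z)%g w).

Lemma tproj_pure z v w :
  tproj z (v ⊗ w) = \sum_g hproj grV g v ⊗ hproj grW (g^-1 * z)%g w.
Proof. exact/tlift_pure/balanced_hproj/balanced_tpure. Qed.

Lemma tprojD z s t : tproj z (s + t) = tproj z s + tproj z t.
Proof. exact/tliftD/balanced_hproj/balanced_tpure. Qed.

Lemma tproj_hom z g h v w : cV g v -> cW h w ->
  tproj z (v ⊗ w) = if z == (g * h)%g then v ⊗ w else 0.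
Proof.
move=> gv hw; rewrite tproj_pure (bigD1 g) //= (hproj_id _ gv) big1 => [|k kg].
  rewrite addr0 (hproj_hom _ _ hw) -(inj_eq (mulgI g)) mulKVg.
  by case: eqP => _; rewrite ?tpure0r.
by rewrite (hproj_hom _ _ gv) (negPf kg) tpure0l.
Qed.

Lemma tproj_comp z t : tensor_comp z (tproj z t).
Proof.
elim/tensor_ind: t => [v w|s t cs ct]; last by rewrite tprojD; apply: zspanD.
rewrite tproj_pure; apply: zspan_sum => g; apply: zspan_gen.
exists g, (g^-1 * z)%g, (hproj grV g v), (hproj grW (g^-1 * z)%g w).
by split=> //; [exact: hproj_comp|exact: hproj_comp|rewrite mulKVg].
Qed.

Lemma tproj_sum t : t = \sum_z tproj z t.
Proof.
elim/tensor_ind: t => [v w|s t {1}-> {1}->]; last first.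
  by rewrite -big_split; apply: eq_bigr => z _; rewrite tprojD.
under eq_bigr => z _ do rewrite tproj_pure.
rewrite exchange_big [in LHS](hproj_sum grV v) tpure_suml.
apply: eq_bigr => g _; rewrite [in LHS](hproj_sum grW w) tpure_sumr.
by rewrite (reindex_inj (mulgI g^-1%g)).
Qed.

Lemma tproj0 z : tproj z 0 = 0.
Proof. by apply: (addrI (tproj z 0)); rewrite -tprojD !addr0. Qed.

Lemma tprojN z t : tproj z (- t) = - tproj z t.
Proof. by apply: (addrI (tproj z t)); rewrite -tprojD !subrr tproj0. Qed.

Lemma tproj_id z y t : tensor_comp y t -> tproj z t = if z == y then t else 0.
Proof.
elim=> [|s u _ IHs _ IHu|_ [g [h [v [w [gv hw <- ->]]]]]].
- by rewrite tproj0 if_same.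
- by rewrite tprojD tprojN IHs IHu; case: eqP; rewrite ?subrr.
- exact: tproj_hom.
Qed.

Lemma tensor_grading : is_grading tensor_comp.
Proof.
apply: (grading_of_proj (p := tproj)).
- by move=> g; apply: zspan0.
- by move=> g x y; apply: zspanB.
- exact: tprojD.
- exact: tproj_comp.
- exact: tproj_sum.
- exact: tproj_id.
Qed.

End GradedTensor.

Section Algebras.
Variables (O : comNzRingType) (gbar : finGroupType).

Record gradedAlg := GradedAlg {
  galg :> algType O;
  gcomp : gbar -> galg -> Prop;
  gcompP : is_grading gcomp;
  gcompZ : forall g (k : O) x, gcomp g x -> gcomp g (k *: x);
  gcompM : forall g h x y, gcomp g x -> gcomp h y -> gcomp (g * h)%g (x * y) }.

Definition mutual_inverse (R : pzRingType) (u v : R) : Prop := u * v = 1 /\ v * u = 1.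

Definition is_crossed_product (A : gradedAlg) : Prop :=
  forall g, exists u v : A, gcomp g u /\ mutual_inverse u v.

Record gradedActedAlg := GradedActedAlg {
  acted_alg :> gradedAlg;
  galg_act : gbar -> {lrmorphism acted_alg -> acted_alg};
  galg_act1 : forall c, galg_act 1%g c = c;
  galg_actM : forall g h c, galg_act (g * h)%g c = galg_act g (galg_act h c);
  galg_act_comp : forall g h c, gcomp h c -> gcomp (g * h * g^-1)%g (galg_act g c) }.

Definition centralizer (A : gradedAlg) (c : A) : Prop :=
  forall b : A, gcomp 1%g b -> c * b = b * c.

(* zeta is a grade-preserving equivariant morphism from C to the centralizer of
   the identity component, on which g acts by conjugation by any invertible
   element u of degree g. *)
Record crossedOver (C : gradedActedAlg) := CrossedOver {
  crossed_alg :> gradedAlg;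
  crossedP : is_crossed_product crossed_alg;
  zeta : {lrmorphism C -> crossed_alg};
  zeta_centralizer : forall c, centralizer (zeta c);
  zeta_comp : forall h c, gcomp h c -> gcomp h (zeta c);
  zeta_act : forall g (u v : crossed_alg) c,
    gcomp g u -> mutual_inverse u v -> zeta (galg_act C g c) = u * zeta c * v }.

Section GradedAlgTheory.
Variable A : gradedAlg.

Lemma gcomp1 : gcomp 1%g (1 : A).
Proof.
pose e := hproj (gcompP A) 1%g 1.
have xe g (x : A) : gcomp g x -> x * e = x.
  move=> gx; rewrite -[RHS](hproj_id (gcompP A) gx).
  rewrite (@hproj_eq _ _ _ (gcompP A)
           (fun h => x * hproj (gcompP A) (g^-1 * h)%g 1)) ?mulVg // => [h|].
    by rewrite -[h in gcomp h](mulKVg g); apply: gcompM => //; apply: hproj_comp.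
  rewrite -mulr_sumr -(reindex_inj (mulgI g^-1%g) (P := xpredT)) /=.
  by rewrite -hproj_sum mulr1.
suff <- : e = 1 by apply: hproj_comp.
rewrite -[LHS]mul1r [X in X * e](hproj_sum (gcompP A)) mulr_suml.
rewrite [RHS](hproj_sum (gcompP A)); apply: eq_bigr => g _.
by apply: (xe g); apply: hproj_comp.
Qed.

Lemma mutual_inverse_comp g (u v : A) :
  gcomp g u -> mutual_inverse u v -> gcomp g^-1%g v.
Proof.
move=> gu [uv vu].
have vh h : h != g^-1%g -> hproj (gcompP A) h v = 0.
  move=> hg; rewrite -[LHS]mul1r -vu -mulrA.
  suff -> : u * hproj (gcompP A) h v = 0 by rewrite mulr0.
  transitivity (hproj (gcompP A) (g * h)%g (u * v)).
    rewrite [RHS](@hproj_eq _ _ _ (gcompP A)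
      (fun k => u * hproj (gcompP A) (g^-1 * k)%g v)) ?mulKg // => [k|].
      by rewrite -[k in gcomp k](mulKVg g); apply: gcompM => //; apply: hproj_comp.
    rewrite -mulr_sumr -(reindex_inj (mulgI g^-1%g) (P := xpredT)) /=.
    by rewrite -hproj_sum.
  rewrite uv (hproj_hom _ _ gcomp1); case: eqP => // gh1.
  by case/negP: hg; rewrite -[h](mulKg g) gh1 mulg1.
rewrite [v](hproj_sum (gcompP A)) (bigD1 g^-1%g) //= big1 => [|h /vh //].
by rewrite addr0; apply: hproj_comp.
Qed.

End GradedAlgTheory.

Lemma zetaC (C : gradedActedAlg) (X : crossedOver C) g (x : X) c :
  gcomp g x -> x * zeta X c = zeta X (galg_act C g c) * x.
Proof.
move=> gx; have [u [v [gu uv]]] := crossedP X g.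
have gv := mutual_inverse_comp gu uv.
rewrite (zeta_act _ gu uv); case: uv => uv vu.
have <- : u * (v * x) = x by rewrite mulrA uv mul1r.
rewrite -[LHS]mulrA -zeta_centralizer; last first.
  by rewrite -(mulVg g); apply: gcompM.
by rewrite -!mulrA [v * (u * _)]mulrA vu mul1r.
Qed.

End Algebras.

Section Delta.
Variables (O : comNzRingType) (gbar : finGroupType) (C : gradedActedAlg O gbar).
Variables X Y : crossedOver C.
Implicit Types (x : X) (y : Y).

(* The underlying group of X (x)_C Y^op: the product c y is taken in Y. *)
Definition xtens : zmodType :=
  tensor (fun x (c : C) => x * zeta X c) (fun (c : C) y => zeta Y c * y).

Definition xtens_comp (z : gbar) : xtens -> Prop :=
  tensor_comp (@gcomp _ _ X) (@gcomp _ _ Y) z.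

Lemma xtens_grading : is_grading xtens_comp.
Proof.
apply: (tensor_grading (gcompP X) (gcompP C) (gcompP Y)) => *.
- by rewrite mulrDl.
- by rewrite raddfD mulrDr.
- by rewrite raddfD mulrDl.
- by rewrite mulrDr.
- by apply: gcompM => //; apply: zeta_comp.
- by apply: gcompM => //; apply: zeta_comp.
Qed.

(* [xmul s t] is s * p(t), where p is the projection of X (x)_C Y^op onto its
   component of degree 1, which is Delta. *)
Let xmul1 x y (t : xtens) : xtens :=
  tlift (fun x1 y1 => \sum_g (x * hproj (gcompP X) g x1) ⊗
           (hproj (gcompP Y) (g^-1 * 1)%g y1 * y)) t.

Let xmul1_bal x y : balanced (fun x (c : C) => x * zeta X c)
    (fun (c : C) y => zeta Y c * y)
    (fun x1 y1 => \sum_g (x * hproj (gcompP X) g x1) ⊗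
           (hproj (gcompP Y) (g^-1 * 1)%g y1 * y) : xtens).
Proof.
apply: (@balanced_hproj _ _ _ _ _ _ _ (gcompP X) (gcompP C) (gcompP Y)
  _ _ _ _ _ _ _ _ _ (fun x1 y1 => (x * x1) ⊗ (y1 * y) : xtens)) => *.
- by rewrite mulrDl.
- by rewrite raddfD mulrDr.
- by rewrite raddfD mulrDl.
- by rewrite mulrDr.
- by apply: gcompM => //; apply: zeta_comp.
- by apply: gcompM => //; apply: zeta_comp.
split=> [x1 x2 y1|x1 y1 y2|x1 c y1].
- by rewrite mulrDr tpureDl.
- by rewrite mulrDl tpureDr.
- by rewrite !mulrA tpureA mulrA.
Qed.

Definition xmul (s t : xtens) : xtens := tlift (fun x y => xmul1 x y t) s.

Let xmul1D x y s t : xmul1 x y (s + t) = xmul1 x y s + xmul1 x y t.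
Proof. exact: (tliftD (xmul1_bal x y)). Qed.

Let xmul1_pure x y x1 y1 : xmul1 x y (x1 ⊗ y1) =
  \sum_g (x * hproj (gcompP X) g x1) ⊗ (hproj (gcompP Y) (g^-1 * 1)%g y1 * y).
Proof. exact: (tlift_pure (xmul1_bal x y)). Qed.

Let xmul_bal t : balanced (fun x (c : C) => x * zeta X c)
    (fun (c : C) y => zeta Y c * y) (fun x y => xmul1 x y t).
Proof.
elim/tensor_ind: t => [x1 y1|s t [sDl sDr sA] [tDl tDr tA]]; last first.
  split=> *; rewrite !xmul1D ?sDl ?sDr ?sA ?tDl ?tDr ?tA //; exact: addrACA.
split=> [x x' y|x y y'|x c y]; rewrite !xmul1_pure -?big_split;
  apply: eq_bigr => g _ /=.
- by rewrite mulrDl tpureDl.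
- by rewrite mulrDr tpureDr.
have gX : gcomp g (hproj (gcompP X) g x1) by apply: hproj_comp.
have gY : gcomp g^-1%g (hproj (gcompP Y) (g^-1 * 1)%g y1).
  by rewrite mulg1; apply: hproj_comp.
rewrite [in RHS]mulrA (zetaC _ gY) -[in RHS]mulrA -tpureA.
have {1}-> : c = galg_act C g (galg_act C g^-1%g c) by rewrite -galg_actM mulgV galg_act1.
by rewrite -[in LHS]mulrA -(zetaC _ gX) mulrA.
Qed.

Lemma xmulDl s t u : xmul (s + t) u = xmul s u + xmul t u.
Proof. exact: (tliftD (xmul_bal u)). Qed.

Lemma xmulDr s t u : xmul s (t + u) = xmul s t + xmul s u.
Proof.
elim/tensor_ind: s => [x y|s s' IHs IHs']; last first.
  by rewrite !xmulDl IHs IHs'; exact: addrACA.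
by rewrite /xmul !(tlift_pure (xmul_bal _)) xmul1D.
Qed.

Lemma xmul_pure g x y x1 y1 : gcomp g x1 -> gcomp g^-1%g y1 ->
  xmul (x ⊗ y) (x1 ⊗ y1) = (x * x1) ⊗ (y1 * y).
Proof.
move=> gx1 gy1; rewrite [LHS](tlift_pure (xmul_bal _)) xmul1_pure.
rewrite (bigD1 g) //= (hproj_id _ gx1) mulg1 (hproj_id _ gy1) big1 ?addr0 //.
move=> h hg; rewrite (hproj_hom _ _ gx1) (negPf hg) mulr0; exact: tpure0l.
Qed.

Definition in_delta : {pred xtens} := fun t =>
  `[< zspan (fun t : xtens => exists g x y,
        [/\ gcomp g x, gcomp g^-1%g y & t = x ⊗ y]) t >].

Lemma in_delta_closed : zmod_closed in_delta.
Proof.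
split=> [|x y /asboolP Kx /asboolP Ky]; apply/asboolP; first exact: zspan0.
exact: zspanB.
Qed.

HB.instance Definition _ := GRing.isZmodClosed.Build xtens in_delta
  in_delta_closed.

Record delta : predArgType := DeltaElt { dval :> xtens; dvalP : dval \in in_delta }.

HB.instance Definition _ := [isSub for dval].
HB.instance Definition _ := [Choice of delta by <:].
HB.instance Definition _ := [SubChoice_isSubZmodule of delta by <:].

End Delta.

Arguments in_delta {O gbar C} X Y _.

Section DeltaRing.
Variables (O : comNzRingType) (gbar : finGroupType) (C : gradedActedAlg O gbar).
Variables X Y : crossedOver C.
Notation D := (delta X Y).
Implicit Types (x : X) (y : Y).

(* The element x (x) y of Delta; the default 0 is used only when x (x) y is not
   in Delta, see dval_dpure. *)
Definition dpure x y : D := insubd (0 : D) (x ⊗ y : xtens X Y).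

Lemma dval_dpure g x y : gcomp g x -> gcomp g^-1%g y -> dval (dpure x y) = x ⊗ y.
Proof.
move=> gx gy; apply: insubdK; apply/asboolP/zspan_gen; by exists g, x, y.
Qed.

Lemma xmulBl (s t u : xtens X Y) : xmul (s - t) u = xmul s u - xmul t u.
Proof. by apply/eqP; rewrite eq_sym subr_eq -xmulDl subrK. Qed.

Lemma xmulBr (s t u : xtens X Y) : xmul s (t - u) = xmul s t - xmul s u.
Proof. by apply/eqP; rewrite eq_sym subr_eq -xmulDr subrK. Qed.

Lemma xmul0l (s : xtens X Y) : xmul 0 s = 0.
Proof. by rewrite -{1}(subrr 0) xmulBl subrr. Qed.

Lemma xmul0r (s : xtens X Y) : xmul s 0 = 0.
Proof. by rewrite -{1}(subrr 0) xmulBr subrr. Qed.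

Lemma dval0 : dval (0 : D) = 0. Proof. by []. Qed.
Lemma dvalB : {morph @dval _ _ _ X Y : d e / d - e}.
Proof. by move=> d e; apply: (GRing.raddfB (val : {additive D -> xtens X Y})). Qed.
Lemma dvalD : {morph @dval _ _ _ X Y : d e / d + e}.
Proof. by move=> d e; apply: (GRing.raddfD (val : {additive D -> xtens X Y})). Qed.
Lemma dval_inj : injective (@dval _ _ _ X Y). Proof. exact: val_inj. Qed.

Lemma delta_ind (P : D -> Prop) :
    P 0 -> (forall d e, P d -> P e -> P (d - e)) ->
    (forall g x y, gcomp g x -> gcomp g^-1%g y -> P (dpure x y)) ->
  forall d, P d.
Proof.
move=> P0 PB Pp [t Dt]; have /asboolP St := Dt.
pose Q t := forall Dt : t \in in_delta X Y, P (DeltaElt Dt).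
suff: Q t by apply.
have D_span u : zspan (fun t : xtens X Y => exists g x y,
        [/\ gcomp g x, gcomp g^-1%g y & t = x ⊗ y]) u -> u \in in_delta X Y.
  by move=> Su; apply/asboolP.
elim: St => [Dt'|u v /D_span Du IHu /D_span Dv IHv Dt'|u [g [x [y [gx gy uE]]]] Dt'].
- by have <- : 0 = DeltaElt Dt' by apply: dval_inj.
- have <- : DeltaElt Du - DeltaElt Dv = DeltaElt Dt'.
    by apply: dval_inj; rewrite dvalB.
  exact: PB.
- have <- : dpure x y = DeltaElt Dt'.
    by apply: dval_inj; rewrite (dval_dpure gx gy) -uE.
  exact: Pp gx gy.
Qed.

Lemma xmul_delta (d e : D) : xmul (dval d) (dval e) \in in_delta X Y.
Proof.
elim/delta_ind: d => [|d d' Hd Hd'|g x y gx gy].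
- by rewrite xmul0l rpred0.
- by rewrite dvalB xmulBl rpredB.
elim/delta_ind: e => [|e e' He He'|h x1 y1 hx1 hy1].
- by rewrite xmul0r rpred0.
- by rewrite dvalB xmulBr rpredB.
rewrite (dval_dpure gx gy) (dval_dpure hx1 hy1) (xmul_pure _ _ hx1 hy1).
apply/asboolP/zspan_gen; exists (g * h)%g, (x * x1), (y1 * y).
by split=> //; [exact: gcompM|rewrite invMg; exact: gcompM].
Qed.

Definition delta_mul (d e : D) : D := DeltaElt (xmul_delta d e).

Lemma dval_mul d e : dval (delta_mul d e) = xmul (dval d) (dval e).
Proof. by []. Qed.

Lemma xmulA (t : xtens X Y) (d e : D) :
  xmul t (dval (delta_mul d e)) = xmul (xmul t (dval d)) (dval e).
Proof.
rewrite /=; elim/tensor_ind: t => [x y|t t' IHt IHt']; last first.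
  by rewrite !xmulDl IHt IHt'.
elim/delta_ind: d => [|d d' Hd Hd'|g x1 y1 gx1 gy1].
- by rewrite !(xmul0l, xmul0r).
- by rewrite dvalB !(xmulBl, xmulBr) Hd Hd'.
elim/delta_ind: e => [|e e' He He'|h x2 y2 hx2 hy2].
- by rewrite !xmul0r.
- by rewrite dvalB !xmulBr He He'.
rewrite (dval_dpure gx1 gy1) (dval_dpure hx2 hy2).
rewrite !(xmul_pure _ _ gx1 gy1, xmul_pure _ _ hx2 hy2).
rewrite (@xmul_pure _ _ _ _ _ (g * h)%g) ?mulrA //; first exact: gcompM.
by rewrite invMg; apply: gcompM.
Qed.

Lemma gcomp1V (A : gradedAlg O gbar) : gcomp 1^-1%g (1 : A).
Proof. by rewrite invg1; apply: gcomp1. Qed.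

Lemma dval_dpure1 : dval (dpure 1 1) = 1 ⊗ 1.
Proof. by apply: (@dval_dpure 1%g); [exact: gcomp1|exact: gcomp1V]. Qed.

Lemma xmul1r (t : xtens X Y) : xmul t (dval (dpure 1 1)) = t.
Proof.
rewrite dval_dpure1; elim/tensor_ind: t => [x y|t t' IHt IHt'].
  by rewrite (@xmul_pure _ _ _ _ _ 1%g) ?mulr1 ?mul1r //;
    [exact: gcomp1|exact: gcomp1V].
by rewrite xmulDl IHt IHt'.
Qed.

Lemma delta_mulA : associative delta_mul.
Proof. by move=> d e f; apply: dval_inj; rewrite /= -xmulA. Qed.

Lemma delta_mul1l : left_id (dpure 1 1) delta_mul.
Proof.
move=> d; apply: dval_inj; rewrite /= dval_dpure1.
elim/delta_ind: d => [|d d' Hd Hd'|g x y gx gy].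
- by rewrite xmul0r.
- by rewrite dvalB xmulBr Hd Hd'.
- by rewrite (dval_dpure gx gy) (xmul_pure _ _ gx gy) mulr1 mul1r.
Qed.

Lemma delta_mul1r : right_id (dpure 1 1) delta_mul.
Proof. by move=> d; apply: dval_inj; rewrite /= xmul1r. Qed.

Lemma delta_mulDl : left_distributive delta_mul +%R.
Proof. by move=> d e f; apply: dval_inj; rewrite !(dvalD, dval_mul) xmulDl. Qed.

Lemma delta_mulDr : right_distributive delta_mul +%R.
Proof. by move=> d e f; apply: dval_inj; rewrite !(dvalD, dval_mul) xmulDr. Qed.

(* Delta may be the zero ring even when X and Y are not, hence no nzRingType.
   The scalars of O act on Delta, and so on its modules, through X and Y: scaling
   x (x) y by k gives (k x) (x) y = x (x) (k y), as O maps to C. *)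
HB.instance Definition _ := GRing.Zmodule_isPzRing.Build D
  delta_mulA delta_mul1l delta_mul1r delta_mulDl delta_mulDr.

Lemma dpureM g h x y x1 y1 : gcomp g x -> gcomp g^-1%g y ->
  gcomp h x1 -> gcomp h^-1%g y1 ->
  dpure x y * dpure x1 y1 = dpure (x * x1) (y1 * y).
Proof.
move=> gx gy hx1 hy1; apply: dval_inj; rewrite [LHS]dval_mul.
rewrite (dval_dpure gx gy) (dval_dpure hx1 hy1) (xmul_pure _ _ hx1 hy1).
rewrite (@dval_dpure (g * h)%g) //; first exact: gcompM.
by rewrite invMg; apply: gcompM.
Qed.

Lemma dpureD1 (x1 x2 : X) : gcomp 1%g x1 -> gcomp 1%g x2 ->
  dpure (x1 + x2) 1 = dpure x1 1 + dpure x2 1.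
Proof.
move=> h1 h2; apply: dval_inj; rewrite dvalD.
rewrite !(@dval_dpure 1%g) ?tpureDl //; try exact: gcomp1V.
exact: (gradingD (gcompP X)).
Qed.

End DeltaRing.

Section LmodOf.
Variables (R : pzRingType) (V : zmodType) (act : R -> V -> V).

Record lmod_axioms : Prop := LmodAxioms {
  lmod_actA : forall a b v, act a (act b v) = act (a * b) v;
  lmod_act1 : forall v, act 1 v = v;
  lmod_actDr : forall a u v, act a (u + v) = act a u + act a v;
  lmod_actDl : forall a b v, act (a + b) v = act a v + act b v }.

Definition lmod_sort (P : lmod_axioms) : Type := V.

HB.instance Definition _ P := GRing.Zmodule.on (lmod_sort P).
HB.instance Definition _ P := GRing.Zmodule_isLmodule.Build R (lmod_sort P)
  (lmod_actA P) (lmod_act1 P) (lmod_actDr P) (fun v a b => lmod_actDl P a b v).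

Definition lmod_of (P : lmod_axioms) : lmodType R := lmod_sort P.

End LmodOf.

Section LmodHom.
Variables (R : pzRingType) (U V : lmodType R).

Definition is_lmodhom : {pred (U -> V)} := fun f => `[< linear f >].

Lemma is_lmodhom_closed : zmod_closed is_lmodhom.
Proof.
split=> [|f g /asboolP fl /asboolP gl]; apply/asboolP => a u v.
  by rewrite -[RHS]/(a *: 0 + 0) scaler0 addr0.
by rewrite !fctE fl gl scalerBr opprD addrACA.
Qed.

HB.instance Definition _ := GRing.isZmodClosed.Build (U -> V) is_lmodhom
  is_lmodhom_closed.

Record lmodhom : predArgType := LmodHom {
  hfun :> U -> V; hfunP : hfun \in is_lmodhom }.

HB.instance Definition _ := [isSub for hfun].
HB.instance Definition _ := [Choice of lmodhom by <:].
HB.instance Definition _ := [SubChoice_isSubZmodule of lmodhom by <:].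

Lemma lmodhomP (f : lmodhom) : linear f.
Proof. exact: (asboolW (hfunP f)). Qed.

Lemma lmodhomD (f : lmodhom) u v : f (u + v) = f u + f v.
Proof. by rewrite -[u]scale1r lmodhomP !scale1r. Qed.

Lemma lmodhom0 (f : lmodhom) : f 0 = 0.
Proof. by apply: (addrI (f 0)); rewrite -lmodhomD !addr0. Qed.

Lemma lmodhomZ (f : lmodhom) a u : f (a *: u) = a *: f u.
Proof. by rewrite -[a *: u]addr0 lmodhomP lmodhom0 addr0. Qed.

Lemma lmodhom_eq (f g : lmodhom) : f =1 g -> f = g.
Proof. by move=> fg; apply: val_inj; apply: funext. Qed.

Lemma lmodhom_addE (f g : lmodhom) u : (f + g) u = f u + g u.
Proof. by []. Qed.

Lemma lmodhom_subE (f g : lmodhom) u : (f - g) u = f u - g u.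
Proof. by []. Qed.

Definition lmodhom_of (f : U -> V) (fl : linear f) : lmodhom :=
  LmodHom (introT (asboolP _) fl : f \in is_lmodhom).

End LmodHom.

Section TensorMap.
Variables (K : Type) (M N : zmodType) (ra : M -> K -> M) (la : K -> N -> N).

Record tmap_ok (f : M -> M) (g : N -> N) : Prop := TmapOk {
  tmap_okDl : forall m1 m2, f (m1 + m2) = f m1 + f m2;
  tmap_okDr : forall n1 n2, g (n1 + n2) = g n1 + g n2;
  tmap_okl : forall m k, f (ra m k) = ra (f m) k;
  tmap_okr : forall k n, g (la k n) = la k (g n) }.

Definition tmap (f : M -> M) (g : N -> N) : tensor ra la -> tensor ra la :=
  tlift (fun m n => f m ⊗ g n).

Lemma tmap_bal f g : tmap_ok f g -> balanced ra la (fun m n => f m ⊗ g n : tensor ra la).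
Proof.
move=> [fD gD fr gl]; split=> *.
- by rewrite fD tpureDl.
- by rewrite gD tpureDr.
- by rewrite fr gl tpureA.
Qed.

Lemma tmap_pure f g (fg : tmap_ok f g) m n : tmap f g (m ⊗ n) = f m ⊗ g n.
Proof. exact: (tlift_pure (tmap_bal fg)). Qed.

Lemma tmapD f g (fg : tmap_ok f g) s t : tmap f g (s + t) = tmap f g s + tmap f g t.
Proof. exact: (tliftD (tmap_bal fg)). Qed.

Lemma tmap0 f g (fg : tmap_ok f g) : tmap f g 0 = 0.
Proof. by apply: (addrI (tmap f g 0)); rewrite -tmapD ?addr0. Qed.

Lemma tmapB f g (fg : tmap_ok f g) s t : tmap f g (s - t) = tmap f g s - tmap f g t.
Proof. by apply/eqP; rewrite eq_sym subr_eq -tmapD ?subrK. Qed.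

End TensorMap.

Section Gbimod.
Variables (O : comNzRingType) (gbar : finGroupType) (C : gradedActedAlg O gbar).

Record is_gbimod (X Y : crossedOver C) (V : lmodType X) (rmul : V -> Y -> V)
    (comp : gbar -> V -> Prop) : Prop := IsGbimod {
  gbimod_rmulA : forall m y y', rmul (rmul m y) y' = rmul m (y * y');
  gbimod_rmul1 : forall m, rmul m 1 = m;
  gbimod_rmulDl : forall m m' y, rmul (m + m') y = rmul m y + rmul m' y;
  gbimod_rmulDr : forall m y y', rmul m (y + y') = rmul m y + rmul m y';
  gbimod_lrmulA : forall x m y, x *: rmul m y = rmul (x *: m) y;
  gbimod_grading : is_grading comp;
  gbimod_comp : forall g k h x m y, gcomp g x -> comp k m -> gcomp h y ->
    comp (g * k * h)%g (rmul (x *: m) y);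
  gbimod_zeta : forall g m c, comp g m ->
    rmul m (zeta Y c) = zeta X (galg_act C g c) *: m }.

(* O acts through X and through Y; by gbimod_zeta both actions agree. *)
Record gbimod (X Y : crossedOver C) := Gbimod {
  bimod :> lmodType X;
  rmul : bimod -> Y -> bimod;
  bcomp : gbar -> bimod -> Prop;
  gbimodP : is_gbimod rmul bcomp }.

Definition gbimod_iso (X Y : crossedOver C) (U V : gbimod X Y) : Prop :=
  exists f : U -> V, [/\ linear f, forall m y, f (rmul m y) = rmul (f m) y,
    forall g m, bcomp g m -> bcomp g (f m) & bijective f].

Section GbimodTheory.
Variables (X Y : crossedOver C) (U : gbimod X Y).
Implicit Types (m : U) (x : X) (y : Y).

Lemma rmulA m y y' : rmul (rmul m y) y' = rmul m (y * y').
Proof. exact: gbimod_rmulA (gbimodP U) _ _ _. Qed.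
Lemma rmul1 m : rmul m 1 = m.
Proof. exact: gbimod_rmul1 (gbimodP U) _. Qed.
Lemma rmulDl m m' y : rmul (m + m') y = rmul m y + rmul m' y.
Proof. exact: gbimod_rmulDl (gbimodP U) _ _ _. Qed.
Lemma rmulDr m y y' : rmul m (y + y') = rmul m y + rmul m y'.
Proof. exact: gbimod_rmulDr (gbimodP U) _ _ _. Qed.
Lemma lrmulA x m y : x *: rmul m y = rmul (x *: m) y.
Proof. exact: gbimod_lrmulA (gbimodP U) _ _ _. Qed.
Lemma bgrading : is_grading (@bcomp _ _ U).
Proof. exact: gbimod_grading (gbimodP U). Qed.
Lemma rmul_zeta g m c : bcomp g m -> rmul m (zeta Y c) = zeta X (galg_act C g c) *: m.
Proof. exact: gbimod_zeta (gbimodP U) _ _ _. Qed.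
Lemma lcomp g k x m : gcomp g x -> bcomp k m -> bcomp (g * k)%g (x *: m).
Proof.
move=> gx km; rewrite -[x *: m]rmul1 -[(g * k)%g]mulg1.
by apply: (gbimod_comp (gbimodP U)) => //; apply: gcomp1.
Qed.
Lemma rcomp k h m y : bcomp k m -> gcomp h y -> bcomp (k * h)%g (rmul m y).
Proof.
move=> km hy; rewrite -[m]scale1r -[k]mul1g.
by apply: (gbimod_comp (gbimodP U)) => //; apply: gcomp1.
Qed.
Lemma rmul0 y : rmul (0 : U) y = 0.
Proof. by apply: (addrI (rmul 0 y)); rewrite -rmulDl !addr0. Qed.
Lemma rmulBl m m' y : rmul (m - m') y = rmul m y - rmul m' y.
Proof. by apply/eqP; rewrite eq_sym subr_eq -rmulDl subrK. Qed.
End GbimodTheory.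

Section XtensBimod.
Variables X Y : crossedOver C.

Let lok (s : X) : tmap_ok (fun (x : X) (c : C) => x * zeta X c)
  (fun (c : C) (y : Y) => zeta Y c * y) ( *%R s) id.
Proof. by split=> // *; rewrite (mulrDr, mulrA). Qed.

Let rok (t : Y) : tmap_ok (fun (x : X) (c : C) => x * zeta X c)
  (fun (c : C) (y : Y) => zeta Y c * y) id ( *%R^~ t).
Proof. by split=> // *; rewrite (mulrDl, mulrA). Qed.

Definition xtens_lact (s : X) : xtens X Y -> xtens X Y := tmap ( *%R s) id.
Definition xtens_ract (u : xtens X Y) (t : Y) : xtens X Y := tmap id ( *%R^~ t) u.

Lemma xtens_lact_pure s x y : xtens_lact s (x ⊗ y) = (s * x) ⊗ y.
Proof. exact: (tmap_pure (lok s)). Qed.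
Lemma xtens_ract_pure x y t : xtens_ract (x ⊗ y) t = x ⊗ (y * t).
Proof. exact: (tmap_pure (rok t)). Qed.
Lemma xtens_lactD s u v : xtens_lact s (u + v) = xtens_lact s u + xtens_lact s v.
Proof. exact: (tmapD (lok s)). Qed.
Lemma xtens_ractD u v t : xtens_ract (u + v) t = xtens_ract u t + xtens_ract v t.
Proof. exact: (tmapD (rok t)). Qed.

Lemma xtens_lmod : lmod_axioms xtens_lact.
Proof.
split=> [a b|||a b]; last 1 first.
- elim/tensor_ind=> [x y|u v IHu IHv]; last first.
    by rewrite !xtens_lactD IHu IHv; apply: addrACA.
  by rewrite !xtens_lact_pure mulrDl tpureDl.
- elim/tensor_ind=> [x y|u v IHu IHv]; last by rewrite !xtens_lactD IHu IHv.
  by rewrite !xtens_lact_pure mulrA.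
- elim/tensor_ind=> [x y|u v IHu IHv]; last by rewrite !xtens_lactD IHu IHv.
  by rewrite xtens_lact_pure mul1r.
- exact: xtens_lactD.
Qed.

Lemma xtens_gbimod : @is_gbimod X Y (lmod_of xtens_lmod) xtens_ract (@xtens_comp _ _ _ X Y).
Proof.
split.
- elim/tensor_ind=> [x y|u v IHu IHv] s t; last by rewrite !xtens_ractD IHu IHv.
  by rewrite !xtens_ract_pure mulrA.
- elim/tensor_ind=> [x y|u v IHu IHv]; last by rewrite !xtens_ractD IHu IHv.
  by rewrite xtens_ract_pure mulr1.
- exact: xtens_ractD.
- elim/tensor_ind=> [x y|u v IHu IHv] s t; last first.
    by rewrite !xtens_ractD IHu IHv; apply: addrACA.
  by rewrite !xtens_ract_pure mulrDr tpureDr.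
- move=> s u t; rewrite -[LHS]/(xtens_lact s (xtens_ract u t)).
  rewrite -[RHS]/(xtens_ract (xtens_lact s u) t).
  elim/tensor_ind: u => [x y|u v IHu IHv].
    by rewrite !(xtens_ract_pure, xtens_lact_pure).
  by rewrite !(xtens_ractD, xtens_lactD) IHu IHv.
- exact: xtens_grading.
- move=> g k h s u t gs ku ht; rewrite -[_ *: u]/(xtens_lact s u).
  elim: ku => [|{}u v _ IHu _ IHv|_ [k1 [k2 [x [y [k1x k2y <- ->]]]]]].
  + rewrite /xtens_lact (tmap0 (lok s)) /xtens_ract (tmap0 (rok t)).
    exact: zspan0.
  + rewrite /xtens_lact (tmapB (lok s)) /xtens_ract (tmapB (rok t)).
    exact: zspanB.
  + rewrite xtens_lact_pure xtens_ract_pure; apply: zspan_gen.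
    exists (g * k1)%g, (k2 * h)%g, (s * x), (y * t).
    by split=> //; [exact: gcompM|exact: gcompM|rewrite !mulgA].
- move=> g u c gu; rewrite -[_ *: u]/(xtens_lact _ u).
  elim: gu => [|{}u v _ IHu _ IHv|_ [g1 [g2 [x [y [g1x g2y <- ->]]]]]].
  + by rewrite /xtens_lact (tmap0 (lok _)) /xtens_ract (tmap0 (rok _)).
  + rewrite /xtens_lact (tmapB (lok _)) /xtens_ract (tmapB (rok _)).
    by congr (_ - _).
  + rewrite xtens_lact_pure xtens_ract_pure (zetaC _ g2y) -tpureA (zetaC _ g1x).
    by rewrite galg_actM.
Qed.

Definition xtens_bimod : gbimod X Y := Gbimod xtens_gbimod.

End XtensBimod.

End Gbimod.

Section Bitensor.
Variables (O : comNzRingType) (gbar : finGroupType) (C : gradedActedAlg O gbar).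
Variables (X Y Z : crossedOver C) (U : gbimod X Y) (V : gbimod Y Z).

Definition bitens : zmodType :=
  tensor (fun (u : U) (y : Y) => rmul u y) (fun (y : Y) (v : V) => y *: v).

Let lok (x : X) : tmap_ok (fun (u : U) (y : Y) => rmul u y)
  (fun (y : Y) (v : V) => y *: v) ( *:%R x) id.
Proof. by split=> // *; rewrite (scalerDr, lrmulA). Qed.

Let rok (z : Z) : tmap_ok (fun (u : U) (y : Y) => rmul u y)
  (fun (y : Y) (v : V) => y *: v) id (fun v => rmul v z).
Proof. by split=> // *; rewrite (rmulDl, lrmulA). Qed.

Definition bitens_lact (x : X) : bitens -> bitens := tmap ( *:%R x) id.
Definition bitens_ract (t : bitens) (z : Z) : bitens := tmap id (fun v => rmul v z) t.
Definition bitens_comp (g : gbar) : bitens -> Prop :=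
  tensor_comp (@bcomp _ _ _ _ _ U) (@bcomp _ _ _ _ _ V) g.

Lemma bitens_lact_pure x u v : bitens_lact x (u ⊗ v) = (x *: u) ⊗ v.
Proof. exact: (tmap_pure (lok x)). Qed.
Lemma bitens_ract_pure u v z : bitens_ract (u ⊗ v) z = u ⊗ rmul v z.
Proof. exact: (tmap_pure (rok z)). Qed.
Lemma bitens_lactD x s t : bitens_lact x (s + t) = bitens_lact x s + bitens_lact x t.
Proof. exact: (tmapD (lok x)). Qed.
Lemma bitens_ractD s t z : bitens_ract (s + t) z = bitens_ract s z + bitens_ract t z.
Proof. exact: (tmapD (rok z)). Qed.

Lemma bitens_lmod : lmod_axioms bitens_lact.
Proof.
split=> [a b|||a b]; last 1 first.
- elim/tensor_ind=> [u v|s t IHs IHt]; last first.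
    by rewrite !bitens_lactD IHs IHt; apply: addrACA.
  by rewrite !bitens_lact_pure scalerDl tpureDl.
- elim/tensor_ind=> [u v|s t IHs IHt]; last by rewrite !bitens_lactD IHs IHt.
  by rewrite !bitens_lact_pure scalerA.
- elim/tensor_ind=> [u v|s t IHs IHt]; last by rewrite !bitens_lactD IHs IHt.
  by rewrite bitens_lact_pure scale1r.
- exact: bitens_lactD.
Qed.

Lemma bitens_gbimod : @is_gbimod _ _ _ X Z (lmod_of bitens_lmod) bitens_ract bitens_comp.
Proof.
split.
- elim/tensor_ind=> [u v|s t IHs IHt] z z'; last by rewrite !bitens_ractD IHs IHt.
  by rewrite !bitens_ract_pure rmulA.
- elim/tensor_ind=> [u v|s t IHs IHt]; last by rewrite !bitens_ractD IHs IHt.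
  by rewrite bitens_ract_pure rmul1.
- exact: bitens_ractD.
- elim/tensor_ind=> [u v|s t IHs IHt] z z'; last first.
    by rewrite !bitens_ractD IHs IHt; apply: addrACA.
  by rewrite !bitens_ract_pure rmulDr tpureDr.
- move=> x t z; rewrite -[LHS]/(bitens_lact x (bitens_ract t z)).
  rewrite -[RHS]/(bitens_ract (bitens_lact x t) z).
  elim/tensor_ind: t => [u v|s t IHs IHt].
    by rewrite !(bitens_ract_pure, bitens_lact_pure).
  by rewrite !(bitens_ractD, bitens_lactD) IHs IHt.
- apply: (tensor_grading (bgrading U) (gcompP Y) (bgrading V)) => *.
  + exact: rmulDl.
  + exact: rmulDr.
  + exact: scalerDl.
  + exact: scalerDr.
  + exact: rcomp.
  + exact: lcomp.
- move=> g k h x t z gx kt hz; rewrite -[_ *: t]/(bitens_lact x t).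
  elim: kt => [|s {}t _ IHs _ IHt|_ [k1 [k2 [u [v [k1u k2v <- ->]]]]]].
  + rewrite /bitens_lact (tmap0 (lok x)) /bitens_ract (tmap0 (rok z)).
    exact: zspan0.
  + rewrite /bitens_lact (tmapB (lok x)) /bitens_ract (tmapB (rok z)).
    exact: zspanB.
  + rewrite bitens_lact_pure bitens_ract_pure; apply: zspan_gen.
    exists (g * k1)%g, (k2 * h)%g, (x *: u), (rmul v z).
    by split=> //; [exact: lcomp|exact: rcomp|rewrite !mulgA].
- move=> g t c gt; rewrite -[_ *: t]/(bitens_lact _ t).
  elim: gt => [|s {}t _ IHs _ IHt|_ [g1 [g2 [u [v [g1u g2v <- ->]]]]]].
  + by rewrite /bitens_lact (tmap0 (lok _)) /bitens_ract (tmap0 (rok _)).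
  + rewrite /bitens_lact (tmapB (lok _)) /bitens_ract (tmapB (rok _)).
    by congr (_ - _).
  + rewrite bitens_lact_pure bitens_ract_pure (rmul_zeta _ g2v) -tpureA.
    by rewrite (rmul_zeta _ g1u) galg_actM.
Qed.

Definition bitensor : gbimod X Z := Gbimod bitens_gbimod.

End Bitensor.

Section Bihom.
Variables (O : comNzRingType) (gbar : finGroupType) (C : gradedActedAlg O gbar).
Variables (X Y Z : crossedOver C) (U : gbimod X Y) (V : gbimod X Z).

Fact bihom_lact_subproof (y : Y) (f : lmodhom U V) :
  linear (fun u => f (rmul u y)).
Proof. by move=> a u v; rewrite rmulDl -lrmulA lmodhomP. Qed.

Fact bihom_ract_subproof (f : lmodhom U V) (z : Z) :
  linear (fun u => rmul (f u) z).
Proof. by move=> a u v; rewrite lmodhomP rmulDl -lrmulA. Qed.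

Definition bihom_lact y f : lmodhom U V := lmodhom_of (bihom_lact_subproof y f).
Definition bihom_ract f z : lmodhom U V := lmodhom_of (bihom_ract_subproof f z).
Definition bihom_comp (x : gbar) (f : lmodhom U V) : Prop :=
  forall g u, bcomp g u -> bcomp (g * x)%g (f u).

Lemma bihom_lmod : lmod_axioms bihom_lact.
Proof.
split=> [a b f|f|a f f'|a b f]; apply: lmodhom_eq => u.
- by rewrite /= rmulA.
- by rewrite /= rmul1.
- by [].
- by rewrite /= rmulDr lmodhomD.
Qed.

Let hproj_scale (W : crossedOver C) (M : gbimod X W) g x m :
  hproj (bgrading M) g (x *: m) =
  \sum_h hproj (gcompP X) h x *: hproj (bgrading M) (h^-1 * g)%g m.
Proof.
apply: (hproj_la (gcompP X)) => *.
- exact: scalerDl.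
- exact: scalerDr.
- exact: lcomp.
Qed.

Let hom_proj_fun (x : gbar) (f : U -> V) (u : U) : V :=
  \sum_g hproj (bgrading V) (g * x)%g (f (hproj (bgrading U) g u)).

Fact hom_proj_subproof x (f : lmodhom U V) : linear (hom_proj_fun x f).
Proof.
have hD u v : hom_proj_fun x f (u + v) = hom_proj_fun x f u + hom_proj_fun x f v.
  rewrite -big_split; apply: eq_bigr => g _.
  by rewrite hprojD lmodhomD hprojD.
move=> a u v; rewrite hD; congr (_ + _).
rewrite [in RHS](hproj_sum (gcompP X) a) scaler_suml.
rewrite [LHS]/hom_proj_fun; under eq_bigr => g _.
  rewrite hproj_scale (additive_sum (lmodhomD f)).
  rewrite (additive_sum (hprojD _ _)).
  over.
rewrite exchange_big; apply: eq_bigr => h _ /=.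
rewrite /hom_proj_fun scaler_sumr (reindex_inj (mulgI h)).
apply: eq_bigr => l _ /=; rewrite mulKg lmodhomZ hproj_scale.
rewrite (bigD1 h) //= (hproj_id _ (hproj_comp _ _ _)) -!mulgA mulKg.
rewrite big1 ?addr0 // => k kh.
by rewrite (hproj_hom _ _ (hproj_comp _ h a)) (negPf kh) scale0r.
Qed.

Let hom_proj x f : lmodhom U V := lmodhom_of (hom_proj_subproof x f).

Lemma bihom_grading : is_grading bihom_comp.
Proof.
apply: (grading_of_proj (p := hom_proj)).
- by move=> x g u _; apply: (grading0 (bgrading V)).
- by move=> x f f' fx f'x g u gu; apply: (gradingB (bgrading V)); [exact: fx|exact: f'x].
- move=> x f f'; apply: lmodhom_eq => u; rewrite lmodhom_addE /= -big_split.
  by apply: eq_bigr => g _; apply: hprojD.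
- move=> x f g u gu; rewrite /= /hom_proj_fun (bigD1 g) //= big1 => [|h hg].
    by rewrite addr0; apply: hproj_comp.
  by rewrite (hproj_hom _ _ gu) (negPf hg) lmodhom0 hproj0.
- move=> f; apply: lmodhom_eq => u.
  rewrite (@additive_sum _ _ (fun f : lmodhom U V => f u)) //.
  rewrite exchange_big [in LHS](hproj_sum (bgrading U) u) (additive_sum (lmodhomD f)).
  apply: eq_bigr => g _ /=.
  by rewrite [LHS](hproj_sum (bgrading V)) (reindex_inj (mulgI g)).
- move=> x y f fy; apply: lmodhom_eq => u /=.
  have E g : hproj (bgrading V) (g * x)%g (f (hproj (bgrading U) g u)) =
      if x == y then f (hproj (bgrading U) g u) else 0.
    rewrite (hproj_hom _ _ (fy _ _ (hproj_comp _ g u))).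
    by rewrite (inj_eq (mulgI g)).
  rewrite /hom_proj_fun (eq_bigr _ (fun g _ => E g)); case: eqP => _.
    by rewrite -(additive_sum (lmodhomD f)) -hproj_sum.
  by rewrite big1.
Qed.

Lemma bihom_gbimod : @is_gbimod _ _ _ Y Z (lmod_of bihom_lmod) bihom_ract bihom_comp.
Proof.
split.
- by move=> f z z'; apply: lmodhom_eq => u; rewrite /= rmulA.
- by move=> f; apply: lmodhom_eq => u; rewrite /= rmul1.
- by move=> f f' z; apply: lmodhom_eq => u; rewrite /= rmulDl.
- by move=> f z z'; apply: lmodhom_eq => u; rewrite /= rmulDr.
- by move=> y f z; apply: lmodhom_eq => u.
- exact: bihom_grading.
- move=> g k h y f z gy kf hz l u lu /=; rewrite !mulgA.
  by apply: rcomp => //; rewrite -mulgA mulgA; apply: kf; apply: rcomp.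
- move=> g f c gf; apply: lmodhom_eq => u /=.
  rewrite [in LHS](hproj_sum (bgrading U) u) [in RHS](hproj_sum (bgrading U) u).
  rewrite (additive_sum (lmodhomD f)).
  rewrite (@additive_sum _ _ (fun v : V => rmul v (zeta Z c))); last first.
    by move=> v v'; apply: rmulDl.
  rewrite (@additive_sum _ _ (fun v : U => rmul v (zeta Y (galg_act C g c)))).
    rewrite (additive_sum (lmodhomD f)); apply: eq_bigr => h _.
    have hu : bcomp h (hproj (bgrading U) h u) by apply: hproj_comp.
    rewrite (rmul_zeta _ (gf _ _ hu)) (rmul_zeta _ hu) lmodhomZ.
    by rewrite galg_actM.
  by move=> v v'; apply: rmulDl.
Qed.

Definition bihom : gbimod Y Z := Gbimod bihom_gbimod.

End Bihom.

Section Tilde.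
Variables (O : comNzRingType) (gbar : finGroupType) (C : gradedActedAlg O gbar).
Variables (X Y : crossedOver C) (M : lmodType (delta X Y)).

Definition tilde_tens : zmodType :=
  tensor (fun (t : xtens X Y) (d : delta X Y) => xmul t (dval d))
         (fun (d : delta X Y) (m : M) => d *: m).

Let lact0 (s : X) : xtens_lact s (0 : xtens X Y) = 0.
Proof. by apply: (addrI (xtens_lact s 0)); rewrite -xtens_lactD !addr0. Qed.
Let ract0 (s : Y) : xtens_ract (0 : xtens X Y) s = 0.
Proof. by apply: (addrI (xtens_ract 0 s)); rewrite -xtens_ractD !addr0. Qed.

Let xtens_lractA (s : X) (u : xtens X Y) (t : Y) :
  xtens_lact s (xtens_ract u t) = xtens_ract (xtens_lact s u) t.
Proof. exact: (gbimod_lrmulA (xtens_gbimod X Y)). Qed.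

Let xtens_zeta g (t : xtens X Y) c : xtens_comp g t ->
  xtens_ract t (zeta Y c) = xtens_lact (zeta X (galg_act C g c)) t.
Proof. exact: (gbimod_zeta (xtens_gbimod X Y)). Qed.

Lemma xmul_lact (s : X) (t : xtens X Y) (d : delta X Y) :
  xtens_lact s (xmul t (dval d)) = xmul (xtens_lact s t) (dval d).
Proof.
elim/tensor_ind: t => [x y|t t' IHt IHt']; last first.
  by rewrite !(xmulDl, xtens_lactD) IHt IHt'.
elim/delta_ind: d => [|d d' Hd Hd'|g x1 y1 gx gy].
- by rewrite !xmul0r lact0.
- rewrite dvalB !xmulBr -Hd -Hd'; apply/eqP.
  by rewrite eq_sym subr_eq -xtens_lactD subrK.
- rewrite (dval_dpure gx gy) xtens_lact_pure !(xmul_pure _ _ gx gy).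
  by rewrite xtens_lact_pure mulrA.
Qed.

Lemma xmul_ract (t : xtens X Y) (d : delta X Y) (s : Y) :
  xtens_ract (xmul t (dval d)) s = xmul (xtens_ract t s) (dval d).
Proof.
elim/tensor_ind: t => [x y|t t' IHt IHt']; last first.
  by rewrite !(xmulDl, xtens_ractD) IHt IHt'.
elim/delta_ind: d => [|d d' Hd Hd'|g x1 y1 gx gy].
- by rewrite !xmul0r ract0.
- rewrite dvalB !xmulBr -Hd -Hd'; apply/eqP.
  by rewrite eq_sym subr_eq -xtens_ractD subrK.
- rewrite (dval_dpure gx gy) xtens_ract_pure !(xmul_pure _ _ gx gy).
  by rewrite xtens_ract_pure mulrA.
Qed.

Lemma xmul_comp z (t : xtens X Y) (d : delta X Y) :
  xtens_comp z t -> xtens_comp z (xmul t (dval d)).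
Proof.
elim=> [|t1 t2 _ IH1 _ IH2|_ [g [h [x [y [gx hy <- ->]]]]]].
- by rewrite xmul0l; apply: zspan0.
- by rewrite xmulBl; apply: zspanB.
elim/delta_ind: d => [|d d' Hd Hd'|k x1 y1 kx ky].
- by rewrite xmul0r; apply: zspan0.
- by rewrite dvalB xmulBr; apply: zspanB.
rewrite (dval_dpure kx ky) (xmul_pure _ _ kx ky); apply: zspan_gen.
exists (g * k)%g, (k^-1 * h)%g, (x * x1), (y1 * y).
by split=> //; [exact: gcompM|exact: gcompM|rewrite mulgA mulgK].
Qed.

Lemma hproj_xmul z (t : xtens X Y) (d : delta X Y) :
  hproj (xtens_grading X Y) z (xmul t (dval d)) =
  xmul (hproj (xtens_grading X Y) z t) (dval d).
Proof.
rewrite (@hproj_eq _ _ _ (xtens_grading X Y)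
  (fun z => xmul (hproj (xtens_grading X Y) z t) (dval d))) // => [g|].
  by apply: xmul_comp; apply: hproj_comp.
rewrite -(@additive_sum _ _ (fun t => xmul t (dval d))) -?hproj_sum // => u v.
exact: xmulDl.
Qed.

Let lok (s : X) : tmap_ok (fun (t : xtens X Y) (d : delta X Y) => xmul t (dval d))
  (fun (d : delta X Y) (m : M) => d *: m) (xtens_lact s) id.
Proof. by split=> // *; [rewrite xtens_lactD|rewrite xmul_lact]. Qed.

Let rok (s : Y) : tmap_ok (fun (t : xtens X Y) (d : delta X Y) => xmul t (dval d))
  (fun (d : delta X Y) (m : M) => d *: m) (fun t => xtens_ract t s) id.
Proof. by split=> // *; [rewrite xtens_ractD|rewrite xmul_ract]. Qed.

Let pok z : tmap_ok (fun (t : xtens X Y) (d : delta X Y) => xmul t (dval d))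
  (fun (d : delta X Y) (m : M) => d *: m) (hproj (xtens_grading X Y) z) id.
Proof. by split=> // *; [rewrite hprojD|rewrite hproj_xmul]. Qed.

Definition tilde_lact (s : X) : tilde_tens -> tilde_tens := tmap (xtens_lact s) id.
Definition tilde_ract (w : tilde_tens) (s : Y) : tilde_tens :=
  tmap (fun t => xtens_ract t s) id w.
Definition tilde_comp (z : gbar) : tilde_tens -> Prop :=
  zspan (fun w => exists (t : xtens X Y) (m : M), xtens_comp z t /\ w = t ⊗ m).

Lemma tilde_lact_pure s t m : tilde_lact s (t ⊗ m) = xtens_lact s t ⊗ m.
Proof. exact: (tmap_pure (lok s)). Qed.
Lemma tilde_ract_pure t m s : tilde_ract (t ⊗ m) s = xtens_ract t s ⊗ m.
Proof. exact: (tmap_pure (rok s)). Qed.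
Lemma tilde_lactD s v w : tilde_lact s (v + w) = tilde_lact s v + tilde_lact s w.
Proof. exact: (tmapD (lok s)). Qed.
Lemma tilde_ractD v w s : tilde_ract (v + w) s = tilde_ract v s + tilde_ract w s.
Proof. exact: (tmapD (rok s)). Qed.

Lemma tilde_lactB s v w : tilde_lact s (v - w) = tilde_lact s v - tilde_lact s w.
Proof. exact: (tmapB (lok s)). Qed.
Lemma tilde_ractB v w s : tilde_ract (v - w) s = tilde_ract v s - tilde_ract w s.
Proof. exact: (tmapB (rok s)). Qed.
Lemma tilde_lact0 s : tilde_lact s 0 = 0.
Proof. exact: (tmap0 (lok s)). Qed.
Lemma tilde_ract0 s : tilde_ract 0 s = 0.
Proof. exact: (tmap0 (rok s)). Qed.

Lemma tilde_lmod : lmod_axioms tilde_lact.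
Proof.
have L := xtens_lmod X Y.
split=> [a b|||a b]; last 1 first.
- elim/tensor_ind=> [t m|v w IHv IHw]; last first.
    by rewrite !tilde_lactD IHv IHw; apply: addrACA.
  by rewrite !tilde_lact_pure (lmod_actDl L) tpureDl.
- elim/tensor_ind=> [t m|v w IHv IHw]; last by rewrite !tilde_lactD IHv IHw.
  by rewrite !tilde_lact_pure (lmod_actA L).
- elim/tensor_ind=> [t m|v w IHv IHw]; last by rewrite !tilde_lactD IHv IHw.
  by rewrite tilde_lact_pure (lmod_act1 L).
- exact: tilde_lactD.
Qed.

Lemma tilde_grading : is_grading tilde_comp.
Proof.
pose p z : tilde_tens -> tilde_tens := tmap (hproj (xtens_grading X Y) z) id.
apply: (grading_of_proj (p := p)).
- by move=> g; apply: zspan0.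
- by move=> g v w; apply: zspanB.
- by move=> g v w; apply: (tmapD (pok g)).
- move=> g; elim/tensor_ind=> [t m|v w IHv IHw].
    rewrite /p (tmap_pure (pok g)); apply: zspan_gen.
    by exists (hproj (xtens_grading X Y) g t), m; split=> //; apply: hproj_comp.
  by rewrite /p (tmapD (pok g)); apply: zspanD.
- elim/tensor_ind=> [t m|v w {1}-> {1}->].
    rewrite [in LHS](hproj_sum (xtens_grading X Y) t) tpure_suml.
    by apply: eq_bigr => z _; rewrite /p (tmap_pure (pok z)).
  rewrite -big_split; apply: eq_bigr => z _.
  by rewrite /p (tmapD (pok z)).
- move=> g h w; elim=> [|v {}w _ IHv _ IHw|_ [t [m [ht ->]]]].
  + by rewrite /p (tmap0 (pok g)) if_same.
  + by rewrite /p (tmapB (pok g)) -!/(p g _) IHv IHw; case: eqP; rewrite ?subrr.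
  + rewrite /p (tmap_pure (pok g)) (hproj_hom _ _ ht).
    by case: eqP => // _; apply: tpure0l.
Qed.

Lemma tilde_gbimod : @is_gbimod _ _ _ X Y (lmod_of tilde_lmod) tilde_ract tilde_comp.
Proof.
have B := xtens_gbimod X Y.
split.
- elim/tensor_ind=> [t m|v w IHv IHw] a b; last by rewrite !tilde_ractD IHv IHw.
  by rewrite !tilde_ract_pure (gbimod_rmulA B).
- elim/tensor_ind=> [t m|v w IHv IHw]; last by rewrite !tilde_ractD IHv IHw.
  by rewrite tilde_ract_pure (gbimod_rmul1 B).
- exact: tilde_ractD.
- elim/tensor_ind=> [t m|v w IHv IHw] a b; last first.
    by rewrite !tilde_ractD IHv IHw; apply: addrACA.
  by rewrite !tilde_ract_pure (gbimod_rmulDr B) tpureDl.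
- move=> s w a; rewrite -[LHS]/(tilde_lact s (tilde_ract w a)).
  rewrite -[RHS]/(tilde_ract (tilde_lact s w) a).
  elim/tensor_ind: w => [t m|v w IHv IHw].
    by rewrite !(tilde_ract_pure, tilde_lact_pure) xtens_lractA.
  by rewrite !(tilde_ractD, tilde_lactD) IHv IHw.
- exact: tilde_grading.
- move=> g k h s w a gs kw ha; rewrite -[_ *: w]/(tilde_lact s w).
  elim: kw => [|v {}w _ IHv _ IHw|_ [t [m [kt ->]]]].
  + by rewrite tilde_lact0 tilde_ract0; apply: zspan0.
  + by rewrite tilde_lactB tilde_ractB; apply: zspanB.
  + rewrite tilde_lact_pure tilde_ract_pure; apply: zspan_gen.
    exists (xtens_ract (xtens_lact s t) a), m; split=> //.
    exact: (gbimod_comp B gs kt ha).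
- move=> g w c gw; rewrite -[_ *: w]/(tilde_lact _ w).
  elim: gw => [|v {}w _ IHv _ IHw|_ [t [m [gt ->]]]].
  + by rewrite tilde_lact0 tilde_ract0.
  + by rewrite tilde_lactB tilde_ractB IHv IHw.
  + by rewrite tilde_lact_pure tilde_ract_pure (xtens_zeta c gt).
Qed.

Definition tilde : gbimod X Y := Gbimod tilde_gbimod.

End Tilde.

Section IdentityComponent.
Variables (O : comNzRingType) (gbar : finGroupType) (A : gradedAlg O gbar).

Definition in_idcomp : {pred A} := fun x => `[< gcomp 1%g x >].

Lemma in_idcomp_closed : subring_closed in_idcomp.
Proof.
split=> [|x y /asboolP hx /asboolP hy|x y /asboolP hx /asboolP hy]; apply/asboolP.
- exact: gcomp1.
- exact: (gradingB (gcompP A)).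
- by rewrite -[1%g]mulg1; apply: gcompM.
Qed.

HB.instance Definition _ := GRing.isSubringClosed.Build A in_idcomp
  in_idcomp_closed.

Record idcomp : predArgType := IdComp { ival :> A; ivalP : ival \in in_idcomp }.

HB.instance Definition _ := [isSub for ival].
HB.instance Definition _ := [Choice of idcomp by <:].
HB.instance Definition _ := [SubChoice_isSubNzRing of idcomp by <:].

Lemma idcomp_comp (b : idcomp) : gcomp 1%g (ival b).
Proof. exact: (asboolW (ivalP b)). Qed.

End IdentityComponent.

Section Restriction.
Variables (O : comNzRingType) (gbar : finGroupType) (C : gradedActedAlg O gbar).
Variables (X Y : crossedOver C) (M : lmodType (delta X Y)).

Definition idcomp_lact (b : idcomp X) (m : M) : M := dpure (ival b) (1 : Y) *: m.
Definition idcomp_ract (m : M) (b : idcomp Y) : M := dpure (1 : X) (ival b) *: m.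

Lemma idcomp_lmod : lmod_axioms idcomp_lact.
Proof.
have e1 := gcomp1V Y.
split=> [a b m|m|a m m'|a b m]; rewrite /idcomp_lact.
- rewrite scalerA (@dpureM _ _ _ _ _ 1%g 1%g) ?mulr1 //; exact: idcomp_comp.
- exact: scale1r.
- exact: scalerDr.
- by rewrite -scalerDl -dpureD1 //; apply: idcomp_comp.
Qed.

Definition lrestr : lmodType (idcomp X) := lmod_of idcomp_lmod.

End Restriction.

Section TensorHomOverB.
Variables (O : comNzRingType) (gbar : finGroupType) (C : gradedActedAlg O gbar).

Definition mtens (X Y Z : crossedOver C) (M : lmodType (delta X Y))
    (M' : lmodType (delta Y Z)) : zmodType :=
  tensor (@idcomp_ract _ _ _ X Y M) (@idcomp_lact _ _ _ Y Z M').

Definition mhom (X Y Z : crossedOver C) (M : lmodType (delta X Y))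
    (M' : lmodType (delta X Z)) : zmodType :=
  lmodhom (lrestr M) (lrestr M').

End TensorHomOverB.

(* Main.v *)
(* Over crossed products, V |-> V_1 is an equivalence from graded bimodules to
   Delta-modules with quasi-inverse M |-> tilde M: a component V_g is u V_1 for
   any unit u of degree g. So an additive bijection phi from a group M onto V_1
   transports to M a Delta-module structure for which tilde M is isomorphic to V.
   For V = tilde M (x)_A' tilde M', phi sends m (x) m' to (1 m) (x) (1 m'), and
   its inverse is read off from w (x) w' = sum_g w_(g^-1) u_g (x) v_g w'_g on V_1,
   where v_g is the inverse of u_g. For V = Hom_A'(tilde M, tilde M'), phi extends
   f : M -> M' to w |-> sum_g u_g f(v_g w_g). The two formulas for the action then
   express that phi is Delta-equivariant. *)

Require Import Defs.
From mathcomp Require Import all_boot all_order all_fingroup all_algebra.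
From mathcomp Require Import boolp.

Set Implicit Arguments.
Unset Strict Implicit.
Unset Printing Implicit Defensive.

Import GRing.Theory.
Local Open Scope ring_scope.

Lemma additive0 (U V : zmodType) (f : U -> V) :
  (forall x y, f (x + y) = f x + f y) -> f 0 = 0.
Proof. by move=> fD; apply: (addrI (f 0)); rewrite -fD !addr0. Qed.

Lemma additiveB (U V : zmodType) (f : U -> V) :
  (forall x y, f (x + y) = f x + f y) -> forall x y, f (x - y) = f x - f y.
Proof. by move=> fD x y; apply/eqP; rewrite eq_sym subr_eq -fD subrK. Qed.

(** * [M] as the degree 1 component of [tilde M] *)

Section DegreeOne.
Variables (O : comNzRingType) (gbar : finGroupType) (C : gradedActedAlg O gbar).
Variables (X Y : crossedOver C).

(** In a generator of degree 1 the second degree is forced to be the inverse of the first. With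
    [xtens_comp_dval], this identifies Delta with the degree 1 component of the graded tensor
    product. *)
Lemma in_deltaP (t : xtens X Y) : xtens_comp 1%g t -> t \in in_delta X Y.
Proof.
elim=> [|s u _ IHs _ IHu|_ [g [h [x [y [gx hy gh1 ->]]]]]]; first exact: rpred0.
  exact: rpredB.
apply/asboolP/zspan_gen; exists g, x, y; split=> //.
by rewrite (_ : g^-1%g = h) // -[h](mulKg g) gh1 mulg1.
Qed.

Lemma xtens_comp_dval (d : delta X Y) : xtens_comp 1%g (dval d).
Proof.
elim/delta_ind: d => [|d e Hd He|g x y gx gy]; first exact: zspan0.
  by rewrite dvalB; apply: zspanB.
rewrite (dval_dpure gx gy); apply: zspan_gen.
by exists g, g^-1%g, x, y; rewrite mulgV.
Qed.

Definition dproj (t : xtens X Y) : delta X Y :=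
  DeltaElt (in_deltaP (hproj_comp (xtens_grading X Y) 1%g t)).

Lemma dprojD s t : dproj (s + t) = dproj s + dproj t.
Proof. by apply: dval_inj; rewrite dvalD /= hprojD. Qed.

(** Right multiplication by Delta preserves degrees, so it commutes with the projection to degree 1.
    This is what makes [tilde_out] balanced. *)
Lemma dproj_xmul t (d : delta X Y) : dproj (xmul t (dval d)) = dproj t * d.
Proof. by apply: dval_inj; rewrite /= hproj_xmul. Qed.

Lemma dproj_dval d : dproj (dval d) = d.
Proof. by apply: dval_inj; rewrite /= (hproj_id _ (xtens_comp_dval d)). Qed.

Lemma dproj_neq1 g t : xtens_comp g t -> g != 1%g -> dproj t = 0.
Proof.
move=> gt g1; apply: dval_inj.
by rewrite /= (hproj_hom _ _ gt) eq_sym (negPf g1).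
Qed.

(** [xmul] projects its second argument to degree 1, so in general 1 ⊗ 1 is a left unit on Delta
    only. *)
Lemma xmul_1l (d : delta X Y) : xmul (1 ⊗ 1) (dval d) = dval d.
Proof. by rewrite -dval_dpure1 -dval_mul delta_mul1l. Qed.

Variable M : lmodType (delta X Y).

Definition tilde_in (m : M) : tilde M := (1 ⊗ 1 : xtens X Y) ⊗ m.

(** The inverse of [tilde_in] on degree 1, extended by 0 to the other degrees so that it is additive
    on all of [tilde M]. *)
Definition tilde_out : tilde M -> M := tlift (fun t m => dproj t *: m).

Let out_bal : balanced (fun (t : xtens X Y) (d : delta X Y) => xmul t (dval d))
  (fun (d : delta X Y) (m : M) => d *: m) (fun t m => dproj t *: m).
Proof.
split=> *.
- by rewrite dprojD scalerDl.
- by rewrite scalerDr.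
- by rewrite dproj_xmul scalerA.
Qed.

Lemma tilde_outD v w : tilde_out (v + w) = tilde_out v + tilde_out w.
Proof. exact: (tliftD out_bal). Qed.

Lemma tilde_out_pure t m : tilde_out (t ⊗ m) = dproj t *: m.
Proof. exact: (tlift_pure out_bal). Qed.

Lemma tilde_inD m n : tilde_in (m + n) = tilde_in m + tilde_in n.
Proof. exact: tpureDr. Qed.

Lemma tilde_pureA t d m :
  (xmul t (dval d) ⊗ m : tilde M) = t ⊗ (d *: m).
Proof. exact: (tpureA (fun t (d : delta X Y) => xmul t (dval d))). Qed.

Lemma tilde_inK : cancel tilde_in tilde_out.
Proof.
by move=> m; rewrite tilde_out_pure -dval_dpure1 dproj_dval; apply: scale1r.
Qed.

Lemma tilde_scale_pure s t m : s *: (t ⊗ m : tilde M) = xtens_lact s t ⊗ m.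
Proof. exact: tilde_lact_pure. Qed.

Lemma tilde_rmul_pure s t m : rmul (t ⊗ m : tilde M) s = xtens_ract t s ⊗ m.
Proof. exact: tilde_ract_pure. Qed.

Lemma tilde_pure m x y : ((x ⊗ y) ⊗ m : tilde M) = rmul (x *: tilde_in m) y.
Proof.
rewrite tilde_scale_pure tilde_rmul_pure xtens_lact_pure xtens_ract_pure.
by rewrite mulr1 mul1r.
Qed.

(** The element x ⊗ y lies in Delta, so it passes through the tensor sign. Thus [tilde_in] is
    Delta-equivariant when Delta acts on degree 1 by w ↦ x w y. *)
Lemma tilde_inZ g x y m : gcomp g x -> gcomp g^-1%g y ->
  tilde_in (dpure x y *: m) = rmul (x *: tilde_in m) y.
Proof.
by move=> gx gy; rewrite -tilde_pure /tilde_in -tilde_pureA xmul_1l (dval_dpure gx gy).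
Qed.

Lemma tilde_in_comp m : bcomp 1%g (tilde_in m).
Proof.
apply: zspan_gen; exists (1 ⊗ 1), m; split=> //.
rewrite -dval_dpure1; exact: xtens_comp_dval.
Qed.

(** A tensor t of degree 1 lies in Delta, whence t ⊗ m = 1 ⊗ t m. *)
Lemma tilde_outK w : bcomp 1%g w -> tilde_in (tilde_out w) = w.
Proof.
elim=> [|v {}w _ IHv _ IHw|_ [t [m [t1 ->]]]].
- by rewrite (additive0 tilde_outD) (additive0 tilde_inD).
- by rewrite (additiveB tilde_outD) (additiveB tilde_inD) IHv IHw.
rewrite tilde_out_pure /tilde_in -tilde_pureA xmul_1l.
by rewrite /= (hproj_id _ t1).
Qed.

Lemma tilde_out_neq1 g w : bcomp g w -> g != 1%g -> tilde_out w = 0.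
Proof.
move=> + g1; elim=> [|v {}w _ IHv _ IHw|_ [t [m [gt ->]]]].
- exact: (additive0 tilde_outD).
- by rewrite (additiveB tilde_outD) IHv IHw subrr.
by rewrite tilde_out_pure (dproj_neq1 gt g1) scale0r.
Qed.

(** The map w ↦ x w y conjugates degrees by g, so it respects the splitting into degree 1 and the
    rest; [tilde_out] kills the rest, and [tilde_inZ] settles degree 1. *)
Lemma tilde_outZ g x y w : gcomp g x -> gcomp g^-1%g y ->
  tilde_out (rmul (x *: w) y) = dpure x y *: tilde_out w.
Proof.
move=> gx gy; rewrite [w](hproj_sum (bgrading (tilde M))).
elim/big_ind: _ => [|v {}w IHv IHw|k _].
- by rewrite scaler0 rmul0 (additive0 tilde_outD) scaler0.
- by rewrite scalerDr rmulDl !tilde_outD IHv IHw scalerDr.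
set v := hproj _ _ _; have kv : bcomp k v by apply: hproj_comp.
have [k1|k1] := eqVneq k 1%g.
  rewrite k1 in kv; rewrite -[in LHS](tilde_outK kv) -(tilde_inZ _ gx gy).
  exact: tilde_inK.
rewrite (tilde_out_neq1 kv k1) scaler0.
apply: (tilde_out_neq1 (g := (g * k * g^-1)%g)).
  exact: rcomp (lcomp gx kv) gy.
apply: contraNneq k1 => /(canRL (mulgKV g)); rewrite mul1g.
by move/(canRL (mulKg g)); rewrite mulVg => ->.
Qed.

Lemma tilde_outZl b w : gcomp 1%g b ->
  tilde_out (b *: w) = dpure b 1 *: tilde_out w.
Proof.
by move=> b1; rewrite -[in LHS](rmul1 w) lrmulA (tilde_outZ _ b1) //; apply: gcomp1V.
Qed.

Lemma tilde_outZr b w : gcomp 1%g b ->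
  tilde_out (rmul w b) = dpure 1 b *: tilde_out w.
Proof.
move=> b1; rewrite -[w in LHS]scale1r (@tilde_outZ 1%g) ?invg1 //; exact: gcomp1.
Qed.

Lemma tilde_inZl b m : gcomp 1%g b -> tilde_in (dpure b 1 *: m) = b *: tilde_in m.
Proof. by move=> b1; rewrite (tilde_inZ _ b1) ?rmul1 //; apply: gcomp1V. Qed.

Lemma tilde_inZr b m : gcomp 1%g b -> tilde_in (dpure 1 b *: m) = rmul (tilde_in m) b.
Proof.
move=> b1; rewrite (@tilde_inZ 1%g) ?scale1r ?invg1 //; exact: gcomp1.
Qed.

Lemma tilde_in_scale_comp g m x : gcomp g x -> bcomp g (x *: tilde_in m).
Proof. by move=> gx; rewrite -[g]mulg1; apply: lcomp gx _; apply: tilde_in_comp. Qed.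

End DegreeOne.

(** * Transport of a Delta-module structure from the degree 1 component of a graded bimodule *)

Section Transport.
Variables (O : comNzRingType) (gbar : finGroupType) (C : gradedActedAlg O gbar).
Variables (X Y : crossedOver C) (V : gbimod X Y).

(* The formula x (x) y |-> x v y respects the tensor product over C only when v
   has degree 1. *)
Definition bact (t : xtens X Y) (v : V) : V :=
  tlift (fun x y => rmul (x *: v) y) t.

Section BactTheory.
Variables (v : V) (v1 : bcomp 1%g v).

Let bact_bal : balanced (fun x (c : C) => x * zeta X c)
  (fun (c : C) y => zeta Y c * y) (fun x y => rmul (x *: v) y).
Proof.
split=> [x x' y|x y y'|x c y].
- by rewrite scalerDl rmulDl.
- by rewrite rmulDr.
by rewrite -scalerA -rmulA -[rmul (_ *: v) _]lrmulA (rmul_zeta c v1) galg_act1.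
Qed.

Lemma bactDl s t : bact (s + t) v = bact s v + bact t v.
Proof. exact: (tliftD bact_bal). Qed.

Lemma bact0l : bact 0 v = 0.
Proof. exact: (additive0 bactDl). Qed.

Lemma bactBl s t : bact (s - t) v = bact s v - bact t v.
Proof. exact: (additiveB bactDl). Qed.

Lemma bact_pure x y : bact (x ⊗ y) v = rmul (x *: v) y.
Proof. exact: (tlift_pure bact_bal). Qed.

Lemma bact_comp z t : xtens_comp z t -> bcomp z (bact t v).
Proof.
elim=> [|s u _ IHs _ IHu|_ [g [h [x [y [gx hy <- ->]]]]]].
- by rewrite bact0l; apply: (grading0 (bgrading V)).
- by rewrite bactBl; apply: (gradingB (bgrading V)).
by rewrite bact_pure; apply: (rcomp _ hy); rewrite -[g]mulg1; apply: lcomp.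
Qed.

Lemma bact_scale x t : bact (xtens_lact x t) v = x *: bact t v.
Proof.
elim/tensor_ind: t => [x1 y|s t IHs IHt].
  by rewrite xtens_lact_pure !bact_pure lrmulA scalerA.
by rewrite xtens_lactD !bactDl IHs IHt scalerDr.
Qed.

Lemma bact_rmul y t : bact (xtens_ract t y) v = rmul (bact t v) y.
Proof.
elim/tensor_ind: t => [x y1|s t IHs IHt].
  by rewrite xtens_ract_pure !bact_pure rmulA.
by rewrite xtens_ractD !bactDl IHs IHt rmulDl.
Qed.

End BactTheory.

Lemma bactDr t v w : bcomp 1%g v -> bcomp 1%g w ->
  bact t (v + w) = bact t v + bact t w.
Proof.
move=> v1 w1; have vw1 := gradingD (bgrading V) v1 w1.
elim/tensor_ind: t => [x y|s t IHs IHt].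
  by rewrite !bact_pure // scalerDr rmulDl.
by rewrite !bactDl // IHs IHt addrACA.
Qed.

Lemma bact_delta_comp (d : delta X Y) v :
  bcomp 1%g v -> bcomp 1%g (bact (dval d) v).
Proof. by move=> v1; apply: bact_comp (xtens_comp_dval d). Qed.

(** Delta preserves degree 1, so the outer action is again applied where the formula on pure tensors
    holds, and x (x1 v y1) y = (x x1) v (y1 y). *)
Lemma bactA t (d : delta X Y) v : bcomp 1%g v ->
  bact t (bact (dval d) v) = bact (xmul t (dval d)) v.
Proof.
move=> v1; have dv1 := bact_delta_comp d v1.
elim/tensor_ind: t => [x y|s t IHs IHt]; last first.
  by rewrite xmulDl !bactDl // IHs IHt.
rewrite bact_pure //; elim/delta_ind: d {dv1} => [|d e IHd IHe|g x1 y1 gx gy].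
- by rewrite xmul0r !bact0l // scaler0 rmul0.
- rewrite dvalB xmulBr !bactBl // scalerDr scalerN.
  by rewrite rmulBl IHd IHe.
rewrite (dval_dpure gx gy) (xmul_pure _ _ gx gy) !bact_pure //.
by rewrite lrmulA rmulA scalerA.
Qed.

Variables (M : zmodType) (phi : M -> V) (psi : V -> M).
Hypotheses (phiD : forall m n, phi (m + n) = phi m + phi n)
  (psiD : forall v w, psi (v + w) = psi v + psi w)
  (phi_comp : forall m, bcomp 1%g (phi m))
  (phiK : cancel phi psi) (psiK : forall v, bcomp 1%g v -> phi (psi v) = v).

(** As [bact] by Delta stays in degree 1, it is enough that [psi] inverts [phi] there; its values in
    other degrees are arbitrary up to additivity. *)
Definition transport_act (d : delta X Y) (m : M) : M := psi (bact (dval d) (phi m)).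

Lemma phi_transport_act d m : phi (transport_act d m) = bact (dval d) (phi m).
Proof. exact/psiK/bact_delta_comp. Qed.

(** The injective map [phi] intertwines the new action with [bact], so each axiom is checked in the
    degree 1 component of [V]. *)
Lemma transport_lmod : lmod_axioms transport_act.
Proof.
split=> [d e m|m|d m n|d e m]; apply: (can_inj phiK).
- by rewrite !phi_transport_act bactA.
- by rewrite phi_transport_act dval_dpure1 bact_pure // scale1r rmul1.
- by rewrite phiD !phi_transport_act phiD bactDr.
- by rewrite phiD !phi_transport_act dvalD bactDl.
Qed.

Notation tM := (tilde (lmod_of transport_lmod)).

Definition transport_iso : tM -> V :=
  tlift (fun t (m : lmod_of transport_lmod) => bact t (phi m)).

Let transport_bal : balanced (fun (t : xtens X Y) (d : delta X Y) => xmul t (dval d))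
  (fun (d : delta X Y) (m : lmod_of transport_lmod) => d *: m)
  (fun t m => bact t (phi m)).
Proof.
split=> [s t m|t m n|t d m]; first by rewrite bactDl.
  by rewrite phiD bactDr.
by rewrite -bactA // -phi_transport_act.
Qed.

Let isoD : forall v w, transport_iso (v + w) = transport_iso v + transport_iso w.
Proof. exact: (tliftD transport_bal). Qed.

Let iso0 : transport_iso 0 = 0.
Proof. exact: (additive0 isoD). Qed.

Let iso_pure t m : transport_iso (t ⊗ m) = bact t (phi m).
Proof. exact: (tlift_pure transport_bal). Qed.

Let isoZ x w : transport_iso (x *: w) = x *: transport_iso w.
Proof.
elim/tensor_ind: w => [t m|v w IHv IHw].
  by rewrite tilde_scale_pure !iso_pure bact_scale.
by rewrite scalerDr !isoD IHv IHw scalerDr.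
Qed.

Let iso_rmul w y : transport_iso (rmul w y) = rmul (transport_iso w) y.
Proof.
elim/tensor_ind: w => [t m|v w IHv IHw].
  by rewrite tilde_rmul_pure !iso_pure bact_rmul.
by rewrite rmulDl !isoD IHv IHw rmulDl.
Qed.

Let iso_comp z w : bcomp z w -> bcomp z (transport_iso w).
Proof.
elim=> [|v {}w _ IHv _ IHw|_ [t [m [zt ->]]]].
- by rewrite iso0; apply: (grading0 (bgrading V)).
- by rewrite (additiveB isoD); apply: (gradingB (bgrading V)).
by rewrite iso_pure; apply: bact_comp.
Qed.

Let iso_in m : transport_iso (tilde_in m) = phi m.
Proof. by rewrite iso_pure bact_pure // scale1r rmul1. Qed.

(** For a unit u of degree g with inverse v, an element w of degree g is u (v w) with v w of degree
    1, hence in the image of [phi]. The inverse map is therefore the sum over g of u_g ⊗ psi (v_g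
    w_g). *)
Lemma transport_iso_bij : bijective transport_iso.
Proof.
(* Choose for every degree a unit of [X] and its inverse. *)
have [u uP] := boolp.choice (crossedP X); have [v {}uP] := boolp.choice uP.
pose inv (w : V) : tM :=
  \sum_g u g *: tilde_in (psi (v g *: hproj (bgrading V) g w) : lmod_of transport_lmod).
have invD : forall w w', inv (w + w') = inv w + inv w'.
  move=> w w'; rewrite -big_split; apply: eq_bigr => g _ /=.
  by rewrite hprojD scalerDr psiD tilde_inD scalerDr.
have inv0 : inv 0 = 0 := additive0 invD.
have v_comp g : gcomp g^-1%g (v g).
  by have [gu uv] := uP g; apply: mutual_inverse_comp uv.
(* On a homogeneous element a single summand of [inv] survives. *)
have inv_hom g w : bcomp g w -> transport_iso (inv w) = w /\
    inv w = u g *: tilde_in (psi (v g *: w) : lmod_of transport_lmod).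
  move=> gw; have invE : inv w = u g *: tilde_in (psi (v g *: w) : lmod_of transport_lmod).
    rewrite /inv (bigD1 g) //= (hproj_id _ gw) big1 ?addr0 // => h hg.
    rewrite (hproj_hom _ _ gw) (negPf hg) scaler0 (additive0 psiD).
    by rewrite (additive0 (@tilde_inD _ _ _ _ _ _)) scaler0.
  split=> //; rewrite invE isoZ iso_in psiK; last by rewrite -(mulVg g); apply: lcomp.
  by rewrite scalerA; have [_ [-> _]] := uP g; rewrite scale1r.
exists inv => w; last first.
  rewrite [w](hproj_sum (bgrading V)).
  elim/big_ind: _ => [|w1 w2 IH1 IH2|g _].
  - by rewrite inv0 iso0.
  - by rewrite invD isoD IH1 IH2.
  by have [] := inv_hom g _ (hproj_comp (bgrading V) g w).
rewrite [w](hproj_sum (bgrading tM)).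
elim/big_ind: _ => [|w1 w2 IH1 IH2|g _].
- by rewrite iso0 inv0.
- by rewrite isoD invD IH1 IH2.
set w' := hproj _ _ _; have gw' : bcomp g w' by apply: hproj_comp.
have [_ ->] := inv_hom g _ (iso_comp gw').
have [_ [uv vu]] := uP g.
have vw'1 : bcomp 1%g (v g *: w') by rewrite -(mulVg g); apply: lcomp.
(* Having degree 1, v_g w' comes from an element of [M], on which [psi] undoes [phi]. *)
rewrite -isoZ -(tilde_outK vw'1) iso_in phiK (tilde_outK vw'1).
by rewrite scalerA uv scale1r.
Qed.

Lemma transport : exists (act : delta X Y -> M -> M) (actP : lmod_axioms act),
  (forall g x y m, gcomp g x -> gcomp g^-1%g y ->
     phi (act (dpure x y) m) = rmul (x *: phi m) y) /\
  gbimod_iso (tilde (lmod_of actP)) V.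
Proof.
exists transport_act, transport_lmod; split=> [g x y m gx gy|].
  by rewrite phi_transport_act (dval_dpure gx gy) bact_pure.
exists transport_iso; split=> [x v w|//|//|]; last exact: transport_iso_bij.
by rewrite isoD isoZ.
Qed.

End Transport.

(** * Tensor products and homomorphisms over the identity component of [A'] *)

Section TensorHom.
Variables (O : comNzRingType) (gbar : finGroupType) (C : gradedActedAlg O gbar).
Variables (A A' A'' : crossedOver C) (u v : gbar -> A').
Hypotheses (u_comp : forall g, gcomp g (u g))
  (uv_inv : forall g, mutual_inverse (u g) (v g)).

Let v_comp g : gcomp g^-1%g (v g).
Proof. exact: mutual_inverse_comp (u_comp g) (uv_inv g). Qed.

Let uv g : u g * v g = 1. Proof. by case: (uv_inv g). Qed.
Let vu g : v g * u g = 1. Proof. by case: (uv_inv g). Qed.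

(** With b = v_(kg) a u_g one has a u_g = u_(kg) b and v_(kg) a = b v_g. An element of degree k thus
    moves past the chosen units at the cost of a factor from the identity component. *)
Let vau_comp k g a : gcomp k a -> gcomp 1%g (v (k * g)%g * a * u g).
Proof.
move=> ka; rewrite -(mulVg (k * g)%g) mulgA.
by apply: gcompM => //; apply: gcompM.
Qed.

(** * The tensor product over the identity component *)

Section Tensor.
Variables (M : lmodType (delta A A')) (M' : lmodType (delta A' A'')).
Notation V := (bitensor (tilde M) (tilde M')).

Lemma mtens_slide b m m' : gcomp 1%g b ->
  ((dpure 1 b *: m) ⊗ m' : mtens M M') = m ⊗ (dpure b 1 *: m').
Proof.
move=> b1; pose b' := IdComp (introT (asboolP _) b1 : b \in @in_idcomp _ _ A').
exact: (tpureA (@idcomp_ract _ _ _ _ _ M) (@idcomp_lact _ _ _ _ _ M') m b' m').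
Qed.

Lemma bitensor_slide a w w' : ((rmul w a) ⊗ w' : V) = w ⊗ (a *: w').
Proof.
exact: (tpureA (fun (u : tilde M) (y : A') => rmul u y)
               (fun (y : A') (v : tilde M') => y *: v)).
Qed.

Definition tens_in : mtens M M' -> V := tlift (fun m m' => tilde_in m ⊗ tilde_in m').

Let in_bal : balanced (@idcomp_ract _ _ _ A A' M) (@idcomp_lact _ _ _ A' A'' M')
  (fun m m' => tilde_in m ⊗ tilde_in m' : V).
Proof.
split=> [m n m'|m m' n'|m b m'].
- by rewrite tilde_inD tpureDl.
- by rewrite tilde_inD tpureDr.
by rewrite (tilde_inZr _ (idcomp_comp b)) bitensor_slide -(tilde_inZl _ (idcomp_comp b)).
Qed.

Lemma tens_inD s t : tens_in (s + t) = tens_in s + tens_in t.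
Proof. exact: (tliftD in_bal). Qed.

Lemma tens_in_pure m m' : tens_in (m ⊗ m') = tilde_in m ⊗ tilde_in m'.
Proof. exact: (tlift_pure in_bal). Qed.

Lemma tens_in_comp t : bcomp 1%g (tens_in t).
Proof.
elim/tensor_ind: t => [m m'|s t IHs IHt]; last first.
  by rewrite tens_inD; apply: (gradingD (bgrading V)).
rewrite tens_in_pure; apply: zspan_gen.
exists 1%g, 1%g, (tilde_in m), (tilde_in m').
by split; rewrite ?mulg1 //; apply: tilde_in_comp.
Qed.

(** No projections are needed: [tilde_out] discards all but degree 1, so the term at g depends only
    on the parts of degree g^-1 of w and g of w'. *)
Let out_fun (w : tilde M) (w' : tilde M') : mtens M M' :=
  \sum_g tilde_out (rmul w (u g)) ⊗ tilde_out (v g *: w').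

Definition tens_out : V -> mtens M M' := tlift out_fun.

Let out_bal : balanced (fun (w : tilde M) (y : A') => rmul w y)
  (fun (y : A') (w' : tilde M') => y *: w') out_fun.
Proof.
split=> [w1 w2 w'|w w1 w2|w a w'].
- by rewrite -big_split; apply: eq_bigr => g _; rewrite rmulDl tilde_outD tpureDl.
- by rewrite -big_split; apply: eq_bigr => g _; rewrite scalerDr tilde_outD tpureDr.
rewrite [a](hproj_sum (gcompP A')).
elim/big_ind: _ => [|a1 a2 IH1 IH2|k _].
- rewrite scale0r /out_fun !big1 // => g _.
    by rewrite scaler0 (additive0 (@tilde_outD _ _ _ _ _ _)) tpure0r.
  rewrite (_ : rmul w 0 = 0) ?rmul0 ?(additive0 (@tilde_outD _ _ _ _ _ _)) ?tpure0l //.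
  exact: (additive0 (@rmulDr _ _ _ _ _ _ w)).
- transitivity (out_fun (rmul w a1) w' + out_fun (rmul w a2) w').
    rewrite -big_split; apply: eq_bigr => g _.
    by rewrite rmulDr rmulDl tilde_outD tpureDl.
  rewrite IH1 IH2 -big_split; apply: eq_bigr => g _.
  by rewrite scalerDl scalerDr tilde_outD tpureDr.
set b := hproj _ _ _; have kb : gcomp k b by apply: hproj_comp.
(* The term at g on the left is matched with the term at kg on the right; they differ by sliding
   v_(kg) b u_g, of degree 1, across the tensor sign. *)
rewrite /out_fun [RHS](reindex_inj (mulgI k)); apply: eq_bigr => g _.
have c1 := vau_comp g kb.
have -> : rmul (rmul w b) (u g) = rmul (rmul w (u (k * g)%g)) (v (k * g)%g * b * u g).
  by rewrite !rmulA !mulrA uv mul1r.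
rewrite (tilde_outZr _ c1) (mtens_slide _ _ c1) -(tilde_outZl _ c1) scalerA.
by rewrite -mulrA uv mulr1 scalerA.
Qed.

Lemma tens_outD s t : tens_out (s + t) = tens_out s + tens_out t.
Proof. exact: (tliftD out_bal). Qed.

Lemma tens_in0 : tens_in 0 = 0.
Proof. exact: (additive0 tens_inD). Qed.

Lemma tens_inB s t : tens_in (s - t) = tens_in s - tens_in t.
Proof. exact: (additiveB tens_inD). Qed.

Lemma tens_out0 : tens_out 0 = 0.
Proof. exact: (additive0 tens_outD). Qed.

Lemma tens_outB s t : tens_out (s - t) = tens_out s - tens_out t.
Proof. exact: (additiveB tens_outD). Qed.

Lemma tens_out_pure g w w' : bcomp g w ->
  tens_out (w ⊗ w') = tilde_out (rmul w (u g^-1)%g) ⊗ tilde_out (v g^-1%g *: w').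
Proof.
move=> gw; rewrite [LHS](tlift_pure out_bal) /out_fun (bigD1 g^-1%g) //=.
rewrite big1 ?addr0 // => h hg; rewrite (tilde_out_neq1 (rcomp gw (u_comp h))) ?tpure0l //.
by apply: contraNneq hg => gh1; rewrite -[h](mulKg g) gh1 mulg1.
Qed.

Lemma tens_inK : cancel tens_in tens_out.
Proof.
elim/tensor_ind=> [m m'|s t IHs IHt]; last by rewrite tens_inD tens_outD IHs IHt.
(* The unit u_1 need not be 1, but it lies in the identity component, so it slides across and
   cancels with v_1. *)
have u1 : gcomp 1%g (u 1%g) by [].
rewrite tens_in_pure (tens_out_pure _ (tilde_in_comp m)) invg1.
rewrite (tilde_outZr _ u1) (mtens_slide _ _ u1) -(tilde_outZl _ u1) scalerA.
by rewrite uv scale1r !tilde_inK.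
Qed.

Lemma tens_outK t : bcomp 1%g t -> tens_in (tens_out t) = t.
Proof.
elim=> [|s {}t _ IHs _ IHt|_ [g [h [w [w' [gw hw' gh1 ->]]]]]].
- rewrite tens_out0; exact: tens_in0.
- by rewrite tens_outB tens_inB IHs IHt.
(* In total degree 1, both w u_h and v_h w' have degree 1, so [tilde_outK] applies to each, and u_h
   v_h cancels across the tensor sign. *)
have hE : h = g^-1%g by rewrite -[h](mulKg g) gh1 mulg1.
rewrite (tens_out_pure _ gw) tens_in_pure !tilde_outK ?bitensor_slide.
- by rewrite scalerA uv scale1r.
- by rewrite -(mulVg h) -hE; apply: lcomp.
- by rewrite -(mulgV g); apply: rcomp.
Qed.

Lemma mtens_transport :
  exists (act : delta A A'' -> mtens M M' -> mtens M M') (actP : lmod_axioms act),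
    (forall g (a : A) (a'' : A'') (m : M) (m' : M'),
       gcomp g a -> gcomp g^-1%g a'' ->
       act (dpure a a'') (m ⊗ m') =
         (dpure a (v g) *: m) ⊗ (dpure (u g) a'' *: m')) /\
    gbimod_iso (tilde (lmod_of actP)) V.
Proof.
have [act [actP [actE iso]]] := transport tens_inD tens_outD tens_in_comp tens_inK tens_outK.
exists act, actP; split=> // g a a'' m m' ga ga''; apply: (can_inj tens_inK).
(* The formula is compared inside the bimodule: in (a m v_g) ⊗ (u_g m' a'') the unit v_g slides to
   the right and cancels u_g, leaving a (m ⊗ m') a''. *)
rewrite (actE _ _ _ _ ga ga'') !tens_in_pure (tilde_inZ _ ga) //.
rewrite (tilde_inZ _ (u_comp g)) // [RHS]bitensor_slide.
have -> : v g *: rmul (u g *: tilde_in m') a'' = rmul (tilde_in m') a''.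
  by rewrite lrmulA scalerA vu scale1r.
rewrite -[LHS]/(bitens_ract (bitens_lact a (tilde_in m ⊗ tilde_in m')) a'').
rewrite bitens_lact_pure.
exact: bitens_ract_pure.
Qed.

End Tensor.

(** * Homomorphisms over the identity component *)

Section Hom.
Variables (M : lmodType (delta A' A)) (M' : lmodType (delta A' A'')).
Notation V := (bihom (tilde M) (tilde M')).

Lemma mhomZ (f : mhom M M') b m : gcomp 1%g b ->
  f (dpure b 1 *: m : M) = dpure b 1 *: (f m : M').
Proof.
move=> b1; pose b' := IdComp (introT (asboolP _) b1 : b \in @in_idcomp _ _ A').
exact: (lmodhomZ f b').
Qed.

(** Since [tilde_out] keeps only degree 1, the term at g sees only the component of w of degree
    g. *)
Let ext_fun (f : mhom M M') (w : tilde M) : tilde M' :=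
  \sum_g u g *: tilde_in (f (tilde_out (v g *: w)) : M').

Let ext_funD f w w' : ext_fun f (w + w') = ext_fun f w + ext_fun f w'.
Proof.
rewrite -big_split; apply: eq_bigr => g _.
by rewrite scalerDr tilde_outD lmodhomD tilde_inD scalerDr.
Qed.

Let ext_fun0 f : ext_fun f 0 = 0.
Proof. exact: (additive0 (ext_funD f)). Qed.

Let ext_fun_hom f g w : bcomp g w ->
  ext_fun f w = u g *: tilde_in (f (tilde_out (v g *: w)) : M').
Proof.
move=> gw; rewrite /ext_fun (bigD1 g) //= big1 ?addr0 // => h hg.
rewrite (tilde_out_neq1 (lcomp (v_comp h) gw)) ?lmodhom0; last first.
  by apply: contraNneq hg => /(canRL (mulKVg h)) ->; rewrite mulg1.
by rewrite (additive0 (@tilde_inD _ _ _ _ _ _)) scaler0.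
Qed.

Fact ext_subproof f : linear (ext_fun f).
Proof.
move=> a w w'; rewrite ext_funD; congr (_ + _).
rewrite [a](hproj_sum (gcompP A')).
elim/big_ind: _ => [|a1 a2 IH1 IH2|k _]; first by rewrite !scale0r ext_fun0.
  by rewrite !scalerDl ext_funD IH1 IH2.
set b := hproj _ _ _; have kb : gcomp k b by apply: hproj_comp.
(* The term at kg for b w is matched with the term at g for w: the factor v_(kg) b u_g has degree 1,
   so f commutes with it, and u_(kg) turns it back into b u_g. *)
rewrite [LHS](reindex_inj (mulgI k)) scaler_sumr; apply: eq_bigr => g _.
have c1 := vau_comp g kb.
have -> : v (k * g)%g *: (b *: w) = (v (k * g)%g * b * u g) *: (v g *: w).
  by rewrite !scalerA -[in RHS]mulrA uv mulr1.
rewrite (tilde_outZl _ c1) (mhomZ _ _ c1) (tilde_inZl _ c1) !scalerA.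
by rewrite !mulrA uv mul1r.
Qed.

Definition hom_in (f : mhom M M') : V := lmodhom_of (ext_subproof f).

Fact hom_out_subproof (F : lmodhom (tilde M) (tilde M')) :
  linear (fun m : lrestr M => tilde_out (F (tilde_in m)) : lrestr M').
Proof.
move=> b m m'; rewrite tilde_inD lmodhomD tilde_outD; congr (_ + _).
rewrite -[b *: m]/(dpure (ival b) 1 *: (m : M)) (tilde_inZl _ (idcomp_comp b)).
by rewrite lmodhomZ (tilde_outZl _ (idcomp_comp b)).
Qed.

Definition hom_out (F : V) : mhom M M' := lmodhom_of (hom_out_subproof F).

Lemma hom_inE f g w : bcomp g w ->
  hfun (hom_in f) w = u g *: tilde_in (f (tilde_out (v g *: w)) : M').
Proof. exact: ext_fun_hom. Qed.

(** The extension uses u_1 and v_1, which need not be 1; v_1 passes through f by linearity over the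
    identity component and cancels. *)
Lemma hom_in_tilde_in f m : hfun (hom_in f) (tilde_in m) = tilde_in (f m : M').
Proof.
have v1 : gcomp 1%g (v 1%g) by have := v_comp 1%g; rewrite invg1.
rewrite (hom_inE _ (tilde_in_comp m)) (tilde_outZl _ v1) tilde_inK (mhomZ _ _ v1).
by rewrite (tilde_inZl _ v1) scalerA uv scale1r.
Qed.

Lemma hom_inD f f' : hom_in (f + f') = hom_in f + hom_in f'.
Proof.
apply: lmodhom_eq => w; rewrite lmodhom_addE /= -big_split.
by apply: eq_bigr => g _; rewrite lmodhom_addE tilde_inD scalerDr.
Qed.

Lemma hom_outD F F' : hom_out (F + F') = hom_out F + hom_out F'.
Proof.
apply: lmodhom_eq => m; rewrite lmodhom_addE /=.
by rewrite -tilde_outD.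
Qed.

Lemma hom_in_comp f : bcomp 1%g (hom_in f).
Proof.
move=> g w gw; rewrite (hom_inE _ gw) mulg1.
exact: tilde_in_scale_comp.
Qed.

Lemma hom_inK : cancel hom_in hom_out.
Proof.
move=> f; apply: lmodhom_eq => m.
exact: etrans (congr1 (@tilde_out _ _ _ _ _ M') (hom_in_tilde_in f m)) (tilde_inK _).
Qed.

(** A graded homomorphism is determined in degree 1, because F(w) = u_g F(v_g w) for w of degree g;
    as F has degree 1, F(v_g w) again has degree 1 and survives [tilde_out]. *)
Lemma hom_outK F : bcomp 1%g F -> hom_in (hom_out F) = F.
Proof.
move=> F1; apply: lmodhom_eq => w; rewrite [w](hproj_sum (bgrading (tilde M))).
elim/big_ind: _ => [|w1 w2 IH1 IH2|g _]; first by rewrite !lmodhom0.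
  by rewrite !lmodhomD IH1 IH2.
set w' := hproj _ _ _; have gw' : bcomp g w' by apply: hproj_comp.
have vw'1 : bcomp 1%g (v g *: w') by rewrite -(mulVg g); apply: lcomp.
rewrite (hom_inE _ gw') /= (tilde_outK vw'1) tilde_outK; last first.
  by rewrite -[1%g]mulg1; apply: F1.
by rewrite lmodhomZ scalerA uv scale1r.
Qed.

Lemma mhom_transport :
  exists (act : delta A A'' -> mhom M M' -> mhom M M') (actP : lmod_axioms act),
    (forall g (a : A) (a'' : A'') (m : M) (f : mhom M M'),
       gcomp g a -> gcomp g^-1%g a'' ->
       hfun (act (dpure a a'') f) m =
         dpure (u g) a'' *: (hfun f (dpure (v g) a *: (m : M)) : M')) /\
    gbimod_iso (tilde (lmod_of actP)) V.
Proof.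
have [act [actP [actE iso]]] := transport hom_inD hom_outD hom_in_comp hom_inK hom_outK.
exists act, actP; split=> // g a a'' m f ga ga''.
(* In v_g ⊗ a the first degree is g^-1, so [tilde_inZ] asks for a in degree (g^-1)^-1. *)
have ga' : gcomp (g^-1)^-1%g a by rewrite invgK.
apply: (can_inj (@tilde_inK _ _ _ _ _ M')); rewrite -hom_in_tilde_in.
rewrite (actE _ _ _ _ ga ga'') (tilde_inZ _ (u_comp g)) // -hom_in_tilde_in.
have -> : tilde_in (dpure (v g) a *: (m : M)) = v g *: rmul (tilde_in m) a.
  by rewrite lrmulA; apply: tilde_inZ (v_comp g) ga'.
(* The extension of f is linear over all of [A'], not only its identity component, so v_g comes out
   and cancels with u_g. *)
have -> : hfun (hom_in f) (v g *: rmul (tilde_in m) a) =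
    v g *: hfun (hom_in f) (rmul (tilde_in m) a).
  exact: lmodhomZ.
by rewrite scalerA uv scale1r.
Qed.

End Hom.

End TensorHom.

Theorem proposition2p12
    (O : idomainType) (O_dvr : is_complete_dvr O)
    (gT : finGroupType) (G N : {group gT}) (nsNG : (N <| G)%g)
    (C : gradedActedAlg O (subg_of (G / N)%G))
    (A A' A'' : crossedOver C)
    (u' v' : subg_of (G / N)%G -> A')
    (u'_comp : forall g, gcomp g (u' g))
    (u'_inv : forall g, mutual_inverse (u' g) (v' g)) :
  (forall (M : lmodType (delta A A')) (M' : lmodType (delta A' A'')),
     exists (act : delta A A'' -> mtens M M' -> mtens M M')
            (actP : lmod_axioms act),
       (forall (g : subg_of (G / N)%G) (a : A) (a'' : A'') (m : M) (m' : M'),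
          gcomp g a -> gcomp g^-1%g a'' ->
          act (dpure a a'') (m ⊗ m') =
            (dpure a (v' g) *: m) ⊗ (dpure (u' g) a'' *: m')) /\
       gbimod_iso (tilde (lmod_of actP)) (bitensor (tilde M) (tilde M')))
  /\
  (forall (M : lmodType (delta A' A)) (M' : lmodType (delta A' A'')),
     exists (act : delta A A'' -> mhom M M' -> mhom M M')
            (actP : lmod_axioms act),
       (forall (g : subg_of (G / N)%G) (a : A) (a'' : A'') (m : M) (f : mhom M M'),
          gcomp g a -> gcomp g^-1%g a'' ->
          hfun (act (dpure a a'') f) m =
            dpure (u' g) a'' *: (hfun f (dpure (v' g) a *: (m : M)) : M')) /\
       gbimod_iso (tilde (lmod_of actP)) (bihom (tilde M) (tilde M'))).
Proof.
split=> M M'; [exact: (mtens_transport u'_comp u'_inv)|].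
exact: (mhom_transport u'_comp u'_inv).
Qed.
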